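(* Let $p>7$ be prime and let $G$ be a pro-$p$-group of Zassenhaus type $(3,7)$ whose abelianization is isomorphic to $\mathbb{Z}/p^a\mathbb{Z}\oplus\mathbb{Z}/p^b\mathbb{Z}$ with $1\le a\le b$. Then $|G|\ge p^{21+a+b}\ge p^{23}$.
   Context: For a pro-$p$-group $G$, given a minimal presentation $1\to R\to F\to G\to1$ with $F$ free pro-$p$ of rank $\dim H^1(G,\mathbb{F}_p)$, and $F_n=\{x\in F: x-1\in I^n\}$ ($I$ the augmentation ideal of the completed group algebra $\mathbb{F}_p[F]$), the level of $1\ne\rho\in F$ is the largest $n$ with $\rho\in F_n$. Relations are chosen inductively so that those of level $n$ together with those of lower levels minimally generate $RF_{n+1}/F_{n+1}$ as normal subgroup of $F/F_{n+1}$; $r_n$ is the number of relations of level $n$. A pro-$p$-group is interesting if it is finite, $\dim H^1(G,\mathbb{F}_p)=\dim H^2(G,\mathbb{F}_p)=2$, and $r_n=0$ for all even $n$; its two relations then have levels $m_1\le m_2$ and $(m_1,m_2)$ is its Zassenhaus type. Being of Zassenhaus type $(3,7)$ means being an interesting pro-$p$-group with $r_3=r_7=1$ and all other $r_n=0$. *)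

(* Defs.v *)
From HB Require Import structures.
From mathcomp Require Import all_boot all_algebra finmap.
From mathcomp Require Import all_classical topology.

Set Implicit Arguments.
Unset Strict Implicit.
Unset Printing Implicit Defensive.

Import GRing.Theory.

Local Open Scope classical_set_scope.
Local Open Scope card_scope.
Local Open Scope ring_scope.

HB.mixin Record Topological_isTopGroup (G : Type)
    of Topological G & Group G := {
  mulg_continuous : continuous (fun xy : G * G => (xy.1 * xy.2)%g);
  invg_continuous : continuous (fun x : G => x^-1%g)
}.

#[short(type="topGroupType")]
HB.structure Definition TopGroup :=
  {G of Topological_isTopGroup G & Topological G & Group G}.

Section Subgroups.
Variable G : groupType.
Implicit Types (A B H N : set G).

Definition subgroup H : Prop :=
  H 1%g /\ forall x y, H x -> H y -> H (x * y^-1)%g.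

Definition normal_subgroup N : Prop :=
  subgroup N /\ forall x y, N x -> N (y^-1 * x * y)%g.

Definition mulset A B : set G := [set (x * y)%g | x in A & y in B].

Definition coset (x : G) N : set G := [set (x * y)%g | y in N].

Definition cosets N : set (set G) := [set coset x N | x in setT].

Definition commutators : set G := [set [~ x, y]%g | x in setT & y in setT].

End Subgroups.

Definition group_hom (G H : groupType) (f : G -> H) : Prop :=
  forall x y, f (x * y)%g = (f x * f y)%g.

Definition kernel (G H : groupType) (f : G -> H) : set G := f @^-1` [set 1%g].

Definition open_normal (G : topGroupType) (N : set G) : Prop :=
  open N /\ normal_subgroup N.

Definition pro_p_group (p : nat) (G : topGroupType) : Prop :=
  [/\ compact [set: G], hausdorff_space G, totally_disconnected [set: G]
    & forall N : set G, open_normal N -> exists k, cosets N #= `I_(p ^ k)].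

Definition free_pro_p (p d : nat) (F : topGroupType) : Prop :=
  pro_p_group p F /\
  exists x : 'I_d -> F,
    forall H : topGroupType, pro_p_group p H -> forall y : 'I_d -> H,
      exists! f : F -> H,
        [/\ group_hom f, continuous f & forall i, f (x i) = y i].

(** Continuous cohomology of [G] with coefficients in the trivial discrete
    module [F_p], by inhomogeneous cochains. *)
Section Cohomology.
Variables (p : nat) (G : topGroupType).

Definition locally_constant (T : topologicalType) (f : T -> 'F_p) : Prop :=
  forall c, open (f @^-1` [set c]).

Definition cocycle1 : set (G -> 'F_p) :=
  [set f | locally_constant f /\
     forall x y, f y - f (x * y)%g + f x = 0].

(* The differential of a 0-cochain vanishes, since the action is trivial. *)
Definition coboundary1 : set (G -> 'F_p) := [set (fun=> 0)].

Definition cocycle2 : set (G * G -> 'F_p) :=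
  [set f | locally_constant f /\
     forall x y z : G,
       f (y, z) - f ((x * y)%g, z) + f (x, (y * z)%g) - f (x, y) = 0].

Definition coboundary2 : set (G * G -> 'F_p) :=
  [set (fun xy => f xy.2 - f (xy.1 * xy.2)%g + f xy.1)
     | f in [set f : G -> 'F_p | locally_constant f]].

(* For subspaces [B `<=` Z]: some [v_1, .., v_d] in [Z] form a basis of
   [Z / B]. *)
Definition quotient_dim (T : Type) (Z B : set (T -> 'F_p)) (d : nat) : Prop :=
  exists v : 'I_d -> T -> 'F_p,
    (forall i, Z (v i)) /\
    forall z, Z z ->
      exists! c : 'rV['F_p]_d, B (fun t => z t - \sum_i c 0 i * v i t).

Definition dim_H1 (d : nat) : Prop := quotient_dim cocycle1 coboundary1 d.
Definition dim_H2 (d : nat) : Prop := quotient_dim cocycle2 coboundary2 d.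

End Cohomology.

(** The completed group algebra of a profinite group [F] over [F_p] is the
    inverse limit of the group algebras [F_p[F/N]] over the open normal
    subgroups [N]. An element is a family [a], where [a N C] is the coefficient
    of the coset [C] in the component at [N]; irrelevant values are set to [0],
    so that Leibniz equality is equality in the algebra. *)
Section CompletedGroupAlgebra.
Variables (p : nat) (F : topGroupType).

Definition coset_family := set F -> set F -> 'F_p.

Definition completed_group_algebra : set coset_family :=
  [set a |
    (forall N C, ~ (open_normal N /\ cosets N C) -> a N C = 0) /\
    (forall M N C, open_normal M -> open_normal N -> M `<=` N ->
       cosets N C ->
       a N C = \sum_(D \in [set D | cosets M D /\ D `<=` C]) a M D)].

(* The product of cosets of a normal subgroup is their product as sets. *)
Definition cga_mul (a b : coset_family) : coset_family := fun N C =>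
  \sum_(DE \in [set DE : set F * set F |
                 [/\ cosets N DE.1, cosets N DE.2 & mulset DE.1 DE.2 = C]])
    a N DE.1 * b N DE.2.

Definition cga_elt (x : F) : coset_family := fun N C =>
  (`[< open_normal N /\ C = coset x N >])%:R.

Definition augmentation_ideal : set coset_family :=
  [set a | completed_group_algebra a /\
    forall N, open_normal N -> \sum_(C \in cosets N) a N C = 0].

Definition additive_subgroup (S : set coset_family) : Prop :=
  S 0 /\ forall a b, S a -> S b -> S (a - b).

Fixpoint augmentation_power (n : nat) : set coset_family :=
  if n is m.+1 then
    smallest additive_subgroup
      [set cga_mul a b | a in augmentation_power m & b in augmentation_ideal]
  else completed_group_algebra.

Definition zassenhaus_filtration (n : nat) : set F :=
  [set x | augmentation_power n (cga_elt x - cga_elt 1%g)].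

(* No [n] is a level of the unit element, as it lies in every step. *)
Definition has_level (x : F) (n : nat) : Prop :=
  zassenhaus_filtration n x /\
  forall m, zassenhaus_filtration m x -> (m <= n)%N.

End CompletedGroupAlgebra.

Definition minimal_presentation (p : nat) (F G : topGroupType) (f : F -> G)
    : Prop :=
  [/\ group_hom f, continuous f, f @` setT = setT
    & exists2 d, dim_H1 p G d & free_pro_p p d F].

Section Relations.
Variables (p : nat) (F : topGroupType) (R : set F).

(* The image of [S] generates [R F_(n+1) / F_(n+1)] as a normal subgroup of
   [F / F_(n+1)], stated in [F] through full preimages. *)
Definition generates_mod (n : nat) (S : set F) : Prop :=
  smallest (@normal_subgroup F) (S `|` zassenhaus_filtration p n.+1) =
  mulset R (zassenhaus_filtration p n.+1).

Definition minimally_generates_mod (n : nat) (S : set F) : Prop :=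
  generates_mod n S /\
  forall T, T `<=` S -> generates_mod n T -> T = S.

(* [rel n] is the set of the chosen relations of level [n]. *)
Definition relation_system (rel : nat -> set F) : Prop :=
  forall n,
    [/\ rel n `<=` R, (forall x, rel n x -> has_level p x n)
      & minimally_generates_mod n (\bigcup_(k in [set k | (k <= n)%N]) rel k)].

End Relations.

(** [r n] is the number of relations of level [n]. *)
Definition relation_numbers (p : nat) (G : topGroupType) (r : nat -> nat)
    : Prop :=
  exists (F : topGroupType) (f : F -> G) (rel : nat -> set F),
    [/\ minimal_presentation p f, relation_system p (kernel f) rel
      & forall n, rel n #= `I_(r n)].

Definition interesting_with (p : nat) (G : topGroupType) (r : nat -> nat)
    : Prop :=
  [/\ pro_p_group p G, finite_set [set: G], dim_H1 p G 2 /\ dim_H2 p G 2,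
      relation_numbers p G r & forall n, ~~ odd n -> r n = 0%N].

Definition interesting (p : nat) (G : topGroupType) : Prop :=
  exists r, interesting_with p G r.

Definition zassenhaus_type (p : nat) (G : topGroupType) (m1 m2 : nat) : Prop :=
  (m1 <= m2)%N /\
  exists2 r, interesting_with p G r &
    forall n, r n = ((n == m1) + (n == m2))%N.

(** [A] is isomorphic to the quotient of [G] by the closure of its commutator
    subgroup. *)
Definition abelianization_isog (G : topGroupType) (A : zmodType) : Prop :=
  exists f : G -> A,
    [/\ forall x y, f (x * y)%g = f x + f y, f @` setT = setT
      & f @^-1` [set 0] = closure (smallest (@subgroup G) (@commutators G))].

Definition group_order (G : topGroupType) : nat := #|` fset_set [set: G]|.

(* Main.v *)
Require Import Defs.
From mathcomp Require Import all_boot all_algebra.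
From HB Require Import structures.
From mathcomp Require Import all_fingroup all_solvable finmap all_classical.
From mathcomp Require Import topology zify ring.

(* Idea. Map the free pro-p group F to the units of the free algebra on X, Y
   over F_p truncated above degree 10, by x -> 1 + X, y -> 1 + Y; then F_n goes
   to 1 + J^n, with J spanned by the nonempty words. As F_11 dies, the kernel of
   F -> G is sent into any subset 1 + V, where V is a subspace closed under
   products and under conjugation by 1 + X and 1 + Y that contains the images
   r3 in J^3 and r7 in J^7 of the two relators minus 1.

   Order words by length, then lexicographically, and let the leading word of
   a series be the smallest one in its support. An iterated commutator along a
   Lyndon word w has image 1 + w + larger words. Hence the products of powers
   z_w^e with 0 <= e < p, taken over the Lyndon words w of length 2 to 10 that
   are not leading words of V, are distinct in the commutator subgroup of G,
   and it suffices to find V missing 21 of these words.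

   The degree 3 part of r3 is a Lie element. If it is nonzero, its leading word
   l is xxy or xyy. Since l does not overlap itself, the ideal I generated by r3
   has dimension the number of words containing l, and 35 Lyndon words of length
   2 to 10 avoid l. Take V = I + the span of the conjugates of r7: the latter is
   spanned modulo I by 1 + 2 + 4 + 7 elements, as r3 acts trivially on it, and
   35 - 14 = 21. If r3 is in J^4, take V = J^8 + the span of the conjugates of
   r3 and of r7: the 39 Lyndon words of length 2 to 7 lose at most
   (1 + 2 + 4 + 8) + 1 = 16. *)

Set Implicit Arguments.
Unset Strict Implicit.
Unset Printing Implicit Defensive.

Import GRing.Theory.

Local Open Scope card_scope.
Local Open Scope ring_scope.

(** * Truncated noncommutative series *)

Section Convolution.
Variable K : fieldType.
Implicit Types (a b c : seq bool -> K) (s t : seq bool).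

(** The Cauchy product over the factorizations of [s], by recursion on [s] so that associativity is
    an induction; [convE] gives the sum. *)
Fixpoint conv a b s : K :=
  if s is x :: s' then a [::] * b s + conv (fun t => a (x :: t)) b s'
  else a [::] * b [::].

Lemma conv_ext a a' b b' s :
    (forall t, (size t <= size s)%N -> a t = a' t) ->
    (forall t, (size t <= size s)%N -> b t = b' t) ->
  conv a b s = conv a' b' s.
Proof.
elim: s a a' => [|x s IHs] a a' eq_a eq_b /=; first by rewrite eq_a ?eq_b.
rewrite eq_a // eq_b //; congr (_ + _); apply: IHs => t lt_t; first exact: eq_a.
by apply: eq_b; apply: leqW.
Qed.

Lemma convDl a a' b s :
  conv (fun t => a t + a' t) b s = conv a b s + conv a' b s.
Proof. by elim: s a a' => [|x s IHs] a a' /=; rewrite ?IHs; ring. Qed.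

Lemma convDr a b b' s :
  conv a (fun t => b t + b' t) s = conv a b s + conv a b' s.
Proof. by elim: s a => [|x s IHs] a /=; rewrite ?IHs; ring. Qed.

Lemma convZl (k : K) a b s : conv (fun t => k * a t) b s = k * conv a b s.
Proof. by elim: s a => [|x s IHs] a /=; rewrite ?IHs; ring. Qed.

Lemma convZr (k : K) a b s : conv a (fun t => k * b t) s = k * conv a b s.
Proof. by elim: s a => [|x s IHs] a /=; rewrite ?IHs; ring. Qed.

Lemma convA a b c s : conv a (conv b c) s = conv (conv a b) c s.
Proof.
elim: s a b => [|x s IHs] a b /=; first by rewrite mulrA.
by rewrite IHs convDl convZl mulrDr mulrA addrA.
Qed.

Lemma conv1l b s : conv (fun t => (t == [::])%:R) b s = b s.
Proof.
case: s => [|x s] /=; rewrite mul1r //.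
suff -> : conv (fun=> false%:R) b s = 0 by rewrite addr0.
by elim: s => [|y s IHs] /=; rewrite mul0r // IHs addr0.
Qed.

Lemma conv1r a s : conv a (fun t => (t == [::])%:R) s = a s.
Proof. by elim: s a => [|x s IHs] a /=; rewrite ?mulr1 // IHs mulr0 add0r. Qed.

Lemma convE a b s :
  conv a b s = \sum_(i < (size s).+1) a (take i s) * b (drop i s).
Proof.
elim: s a => [|x s IHs] a /=; first by rewrite big_ord1 /=.
by rewrite IHs [RHS]big_ord_recl.
Qed.

End Convolution.

(* Noncommutative polynomials in two letters modulo the words of length
   greater than [D]. *)
Definition truncated_series (K : fieldType) (D : nat) :=
  {ffun {bseq D of bool} -> K^o}.

HB.instance Definition _ (K : fieldType) D :=
  Vector.copy (truncated_series K D) {ffun {bseq D of bool} -> K^o}.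

HB.instance Definition _ (K : finFieldType) D :=
  Finite.copy (truncated_series K D) {ffun {bseq D of bool} -> K^o}.

Section TruncatedSeries.
Variables (K : fieldType) (D : nat).
Local Notation A := (truncated_series K D).
Implicit Types (a b c : A) (s t : seq bool).

(** Reading coefficients at arbitrary words, as 0 beyond length [D], keeps length proofs out of the
    statements. *)
Definition cf a s : K := oapp a 0 (insub s).

Definition of_cf (g : seq bool -> K) : A := [ffun w => g (val w)].

Lemma cf_of g s : cf (of_cf g) s = if (size s <= D)%N then g s else 0.
Proof. by rewrite /cf; case: insubP => [w -> <-|/negbTE ->] //=;
  rewrite ffunE. Qed.

Lemma cf_gtD a s : (D < size s)%N -> cf a s = 0.
Proof. by rewrite ltnNge /cf => /negbTE h; rewrite insubF. Qed.

Lemma cfP a b :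
  (forall s, (size s <= D)%N -> cf a s = cf b s) <-> a = b.
Proof.
split=> [eq_ab|-> //]; apply/ffunP=> w.
by have := eq_ab _ (size_bseq w); rewrite /cf valK.
Qed.

Lemma cf0 s : cf 0 s = 0.
Proof. by rewrite /cf; case: insub => //= w; rewrite ffunE. Qed.

Lemma cfD a b s : cf (a + b) s = cf a s + cf b s.
Proof. by rewrite /cf; case: insub => [w|] /=; rewrite ?addr0 // ffunE. Qed.

Lemma cfZ (k : K) a s : cf (k *: a) s = k * cf a s.
Proof. by rewrite /cf; case: insub => [w|] /=; rewrite ?mulr0 // ffunE. Qed.

Lemma cfN a s : cf (- a) s = - cf a s.
Proof. by rewrite -scaleN1r cfZ mulN1r. Qed.

Lemma cfB a b s : cf (a - b) s = cf a s - cf b s.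
Proof. by rewrite cfD cfN. Qed.

Lemma cf_sum (I : Type) (r : seq I) (P : pred I) (f : I -> A) s :
  cf (\sum_(i <- r | P i) f i) s = \sum_(i <- r | P i) cf (f i) s.
Proof. exact: (big_morph (cf^~ s) (fun a b => cfD a b s) (cf0 s)). Qed.

Definition series_mul a b : A := of_cf (conv (cf a) (cf b)).

Definition series_one : A := of_cf (fun s => (s == [::])%:R).

Lemma cf_series_mul a b s :
  (size s <= D)%N -> cf (series_mul a b) s = conv (cf a) (cf b) s.
Proof. by rewrite cf_of => ->. Qed.

Lemma series_mulA : associative series_mul.
Proof.
move=> a b c; apply/cfP=> s sD; rewrite !cf_series_mul //.
transitivity (conv (cf a) (conv (cf b) (cf c)) s).
  by apply: conv_ext => // t ts; rewrite cf_series_mul // (leq_trans ts).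
rewrite convA; apply: conv_ext => // t ts.
by rewrite cf_series_mul // (leq_trans ts).
Qed.

Lemma series_mul1l : left_id series_one series_mul.
Proof.
move=> a; apply/cfP=> s sD; rewrite cf_series_mul // -[RHS]conv1l.
by apply: conv_ext => // t ts; rewrite cf_of (leq_trans ts).
Qed.

Lemma series_mul1r : right_id series_one series_mul.
Proof.
move=> a; apply/cfP=> s sD; rewrite cf_series_mul // -[RHS]conv1r.
by apply: conv_ext => // t ts; rewrite cf_of (leq_trans ts).
Qed.

Lemma series_mulDl : left_distributive series_mul +%R.
Proof.
move=> a b c; apply/cfP=> s sD; rewrite cfD !cf_series_mul // -convDl.
by apply: conv_ext => // t _; rewrite cfD.
Qed.

Lemma series_mulDr : right_distributive series_mul +%R.
Proof.
move=> a b c; apply/cfP=> s sD; rewrite cfD !cf_series_mul // -convDr.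
by apply: conv_ext => // t _; rewrite cfD.
Qed.

Lemma series_one_neq0 : series_one != 0.
Proof.
apply/eqP=> /cfP/(_ [::] isT); rewrite cf0 cf_of /= => /eqP.
by rewrite oner_eq0.
Qed.

HB.instance Definition _ := GRing.Zmodule_isNzRing.Build (truncated_series K D)
  series_mulA series_mul1l series_mul1r series_mulDl series_mulDr
    series_one_neq0.

Lemma cfM a b s :
  (size s <= D)%N ->
  cf (a * b) s = \sum_(i < (size s).+1) cf a (take i s) * cf b (drop i s).
Proof. by move=> sD; rewrite cf_series_mul // convE. Qed.

Lemma cf1 s : cf 1 s = (s == [::])%:R.
Proof. by rewrite cf_of; case: s => //= x s; case: ifP. Qed.

Lemma scale_series_mulAl (k : K) a b : k *: (a * b) = k *: a * b.
Proof.
apply/cfP=> s sD; rewrite cfZ !cf_series_mul // -convZl.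
by apply: conv_ext => // t _; rewrite cfZ.
Qed.

Lemma scale_series_mulAr (k : K) a b : k *: (a * b) = a * (k *: b).
Proof.
apply/cfP=> s sD; rewrite cfZ !cf_series_mul // -convZr.
by apply: conv_ext => // t _; rewrite cfZ.
Qed.

HB.instance Definition _ :=
  GRing.Lmodule_isLalgebra.Build K (truncated_series K D) scale_series_mulAl.
HB.instance Definition _ :=
  GRing.Lalgebra_isAlgebra.Build K (truncated_series K D) scale_series_mulAr.

Definition word s : A := of_cf (fun t => (t == s)%:R).

Lemma cf_word s t : cf (word s) t = ((size t <= D)%N && (t == s))%:R.
Proof. by rewrite cf_of; case: ifP. Qed.

Lemma series_expand a : a = \sum_(w : {bseq D of bool}) cf a w *: word w.
Proof.
apply/cfP=> s sD; rewrite cf_sum (bigD1 (Bseq sD)) //= big1 => [|w w_neq].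
  by rewrite cfZ cf_word sD eqxx mulr1 addr0.
by rewrite cfZ cf_word sD -(inj_eq val_inj) eq_sym in w_neq *;
  rewrite (negbTE w_neq) mulr0.
Qed.

Lemma wordM s t : word s * word t = word (s ++ t).
Proof.
apply/cfP=> r rD; rewrite cfM // cf_word rD /=.
have E (i : 'I_(size r).+1) : cf (word s) (take i r) * cf (word t) (drop i r)
    = ((take i r == s) && (drop i r == t))%:R :> K.
  rewrite !cf_word size_drop size_take_min (leq_trans (leq_subr _ _) rD).
  by rewrite (leq_trans (geq_minr _ _) rD) /= -natrM mulnb.
under eq_bigr do rewrite E.
have [->|r_neq] := eqVneq r (s ++ t).
  have si : (size s < (size (s ++ t)).+1)%N by rewrite size_cat ltnS leq_addr.
  rewrite (bigD1 (Ordinal si)) //= take_size_cat ?drop_size_cat // !eqxx big1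
    ?addr0 //.
  move=> i i_neq; case: eqP => //= ts; case/eqP: i_neq; apply: val_inj => /=.
  by have := congr1 size ts; rewrite size_takel // -ltnS.
rewrite big1 // => i _; case: eqP => //= ts; case: eqP => //= tr.
by rewrite -ts -tr cat_take_drop eqxx in r_neq.
Qed.

End TruncatedSeries.

HB.instance Definition _ (K : finFieldType) D :=
  FinRing.isNzRing.Build (truncated_series K D).

(** * Leading words *)

Section WordCode.
Local Open Scope nat_scope.
Implicit Types s t : seq bool.

(* Comparing codes is comparing words first by length, then
   lexicographically. *)
Definition code s := foldl (fun n (b : bool) => n.*2 + b) 1 s.

Lemma code_rcons s b : code (rcons s b) = (code s).*2 + b.
Proof. by rewrite /code -cats1 foldl_cat. Qed.

(** In binary, [code s] is [s] preceded by a digit 1. Appending [t] shifts [code s] by [size t]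
    digits and adds [code t] without its leading digit. *)
Lemma code_cat s t : code (s ++ t) + 2 ^ size t = code s * 2 ^ size t + code t.
Proof.
elim/last_ind: t => [|t b IHt]; first by rewrite cats0 muln1.
rewrite -rcons_cat !code_rcons size_rcons expnS.
by move: (code _) (code _) (code _) (2 ^ _) IHt => *; nia.
Qed.

Lemma code_bounds s : 2 ^ size s <= code s < 2 ^ (size s).+1.
Proof.
elim/last_ind: s => [//|s b]; rewrite code_rcons size_rcons !expnS.
by move: (code _) (2 ^ _) => *; case: b; lia.
Qed.

Lemma code_gt0 s : 0 < code s.
Proof. by have := code_bounds s; have := expn_gt0 2 (size s); lia. Qed.

Lemma code_size s t : code s <= code t -> size s <= size t.
Proof.
move=> le_st; rewrite -ltnS -(@ltn_exp2l 2) //.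
by have := code_bounds s; have := code_bounds t; lia.
Qed.

Lemma size_code s t : size s < size t -> code s < code t.
Proof. by rewrite !ltnNge; apply: contra; apply: code_size. Qed.

Lemma code_inj : injective code.
Proof.
move=> s t eq_st.
have : size s = size t by apply/eqP; rewrite eqn_leq !code_size ?eq_st.
elim/last_ind: s t eq_st => [|s b IHs] t.
  by case: t.
case/lastP: t => [|t c]; first by rewrite size_rcons.
rewrite !code_rcons !size_rcons => eq_st [eq_sz].
have eq_bc : b = c by case: b c eq_st => -[] //; lia.
by rewrite eq_bc (IHs t) //; move: eq_st; rewrite eq_bc; lia.
Qed.

(** Settled at the first differing letter, hence cheap to evaluate; it is only applied to words of
    equal length. *)
Fixpoint lex_lt s t :=
  match s, t with
  | x :: s', y :: t' => if x == y then lex_lt s' t' else y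
  | _, _ => false
  end.

Lemma lex_lt_code s t : size s = size t -> lex_lt s t -> code s < code t.
Proof.
have C x u : code (x :: u) = x.+1 * 2 ^ size u + code u.
  by have := code_cat [:: x] u; rewrite /= {2}/code /=; case: x => /=; nia.
elim: s t => [|x s IHs] [|y t] //= [eq_sz]; rewrite !C eq_sz.
case: eqP => [<-|xy] lt_st.
  by have := IHs _ eq_sz lt_st; lia.
have := code_bounds s; have := code_bounds t; rewrite eq_sz !expnS.
by case: x xy; case: y lt_st => //= *; lia.
Qed.

(** The lengths are forced to agree, and then the codes compare like binary numbers cut at the same
    place. This makes leading words multiplicative. *)
Lemma code_cat_le s t r1 r2 :
    code s <= code r1 -> code t <= code r2 -> code (r1 ++ r2) <= code (s ++ t)
      ->
  r1 = s /\ r2 = t.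
Proof.
move=> le1 le2 le12; have := code_size le12; rewrite !size_cat.
have := code_size le1; have := code_size le2 => s2 s1 s12.
have [e1 e2] : size s = size r1 /\ size t = size r2 by lia.
have := code_cat s t; have := code_cat r1 r2; rewrite e2.
have := expn_gt0 2 (size r2); set q := 2 ^ _ => q0 E1 E2.
have c1 : code r1 = code s by nia.
by split; apply: code_inj => //; nia.
Qed.

End WordCode.

Section Leading.
Variables (K : fieldType) (D : nat).
Local Notation A := (truncated_series K D).
Implicit Types (a b c : A) (s t : seq bool).

Definition above (n : nat) a := forall s, (code s < n)%N -> cf a s = 0.

(** This is membership in J^n. *)
Definition order_ge (n : nat) a := forall s, (size s < n)%N -> cf a s = 0.

Lemma above0 n : above n 0.
Proof. by move=> s _; rewrite cf0. Qed.

Lemma aboveD n a b : above n a -> above n b -> above n (a + b).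
Proof. by move=> ha hb s sn; rewrite cfD ha // hb // addr0. Qed.

Lemma aboveN n a : above n a -> above n (- a).
Proof. by move=> ha s sn; rewrite cfN ha // oppr0. Qed.

Lemma aboveW m n a : (m <= n)%N -> above n a -> above m a.
Proof. by move=> mn ha s sm; apply: ha; apply: leq_trans mn. Qed.

Lemma above_nil a : above (code [::]) a.
Proof. by move=> s; rewrite ltnNge code_gt0. Qed.

Lemma above_letter a : cf a [::] = 0 -> above (code [:: false]) a.
Proof.
move=> a0 [|x s] // lt_s.
by have := code_size (ltnW lt_s); case: s lt_s => //; case: x.
Qed.

Lemma order_ge0 n : order_ge n 0.
Proof. by move=> s _; rewrite cf0. Qed.

Lemma order_geD n a b : order_ge n a -> order_ge n b -> order_ge n (a + b).
Proof. by move=> ha hb s sn; rewrite cfD ha // hb // addr0. Qed.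

Lemma order_geN n a : order_ge n a -> order_ge n (- a).
Proof. by move=> ha s sn; rewrite cfN ha // oppr0. Qed.

Lemma order_geZ n (k : K) a : order_ge n a -> order_ge n (k *: a).
Proof. by move=> ha s sn; rewrite cfZ ha // mulr0. Qed.

Lemma order_geW m n a : (m <= n)%N -> order_ge n a -> order_ge m a.
Proof. by move=> mn ha s sm; apply: ha; apply: leq_trans mn. Qed.

Lemma order_geM m n a b : order_ge m a -> order_ge n b -> order_ge (m + n) (a *
  b).
Proof.
move=> ha hb s sn; have [sD|?] := leqP (size s) D; last by rewrite cf_gtD.
rewrite cfM // big1 // => i _; have [im|mi] := ltnP i m.
  by rewrite ha ?mul0r // size_takel // -ltnS.
by rewrite (hb (drop i s)) ?mulr0 // size_drop; have := ltn_ord i; lia.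
Qed.

Lemma order_ge_eq0 n a : (D < n)%N -> order_ge n a -> a = 0.
Proof.
by move=> Dn ha; apply/cfP => s sD; rewrite cf0 ha // (leq_ltn_trans sD).
Qed.

Lemma aboveM s t a b :
  above (code s) a -> above (code t) b -> above (code (s ++ t)) (a * b).
Proof.
move=> ha hb r rst; have [rD|?] := leqP (size r) D; last by rewrite cf_gtD.
rewrite cfM // big1 // => i _; have [?|le1] := ltnP (code (take i r)) (code s).
  by rewrite ha ?mul0r.
have [?|le2] := ltnP (code (drop i r)) (code t); first by rewrite hb ?mulr0.
have := @code_cat_le _ _ _ _ le1 le2; rewrite cat_take_drop => /(_ (ltnW rst)).
by case=> e1 e2; move: rst; rewrite -e1 -e2 cat_take_drop ltnn.
Qed.

(** By [code_cat_le], any other cut of [s ++ t] has a factor below the bound for [a] or for [b], so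
    a single term of the product survives. *)
Lemma cfM_lead s t a b : (size (s ++ t) <= D)%N ->
  above (code s) a -> above (code t) b ->
  cf (a * b) (s ++ t) = cf a s * cf b t.
Proof.
move=> stD ha hb; rewrite cfM //.
have si : (size s < (size (s ++ t)).+1)%N by rewrite size_cat ltnS leq_addr.
rewrite (bigD1 (Ordinal si)) //= take_size_cat ?drop_size_cat // big1 ?addr0 //.
move=> i i_neq; have [?|le1] := ltnP (code (take i (s ++ t))) (code s).
  by rewrite ha ?mul0r.
have [?|le2] := ltnP (code (drop i (s ++ t))) (code t);
  first by rewrite hb ?mulr0.
have := @code_cat_le _ _ _ _ le1 le2; rewrite cat_take_drop => /(_ (leqnn _)).
case=> e1 _; case/eqP: i_neq; apply: val_inj => /=.
by have := congr1 size e1; rewrite size_takel // -ltnS.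
Qed.

Definition leads s a := above (code s) a /\ cf a s = 1.

Lemma above_mul_small s a b : cf a [::] = 0 -> above (code s) b ->
  above (code s) (a * b) /\ cf (a * b) s = 0.
Proof.
move=> a0 hb; have h := aboveM (above_letter a0) hb.
have lt : (code s < code ([:: false] ++ s))%N by apply: size_code.
by split; [apply: aboveW h; apply: ltnW | apply: h].
Qed.

Lemma above_mul_unip s a b : cf a [::] = 1 -> above (code s) b ->
  above (code s) (a * b) /\ cf (a * b) s = cf b s.
Proof.
move=> a1 hb; have [sD|sD] := leqP (size s) D.
  by have := aboveM (above_nil a) hb; rewrite (@cfM_lead [::] s) // ?a1 ?mul1r
    //; apply: above_nil.
by rewrite !cf_gtD //; split=> //; exact: (aboveM (above_nil a) hb).
Qed.

End Leading.

(** * Commutators along Lyndon words *)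

Lemma commutatorB1 (R : nzRingType) (x y : R) :
  (x - 1) * (y - 1) - (y - 1) * (x - 1) = x * y - y * x.
Proof.
rewrite !mulrBl !mulrBr !mulr1 !mul1r -[x * y - x - _]addrA -opprD.
by rewrite -[y * x - y - _]addrA -opprD (addrCA y) opprB [LHS]addrA subrK.
Qed.

Section Unipotent.
Variables (K : fieldType) (D : nat).
Local Notation A := (truncated_series K D).
Implicit Types (a b : A) (s t : seq bool).

Lemma code_catr s t : (code t <= code (s ++ t))%N.
Proof. by have := code_cat s t; have := code_gt0 s; nia. Qed.

Lemma above_mull n a b : above n b -> above n (a * b).
Proof.
move=> hb s sn; have [sD|?] := leqP (size s) D; last by rewrite cf_gtD.
rewrite cfM // big1 // => i _; rewrite hb ?mulr0 //.
by apply: leq_ltn_trans sn; have := code_catr (take i s) (drop i s);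
  rewrite cat_take_drop.
Qed.

Variables (G : groupType) (phi : G -> A).
Hypotheses (phiM : forall x y, phi (x * y)%g = phi x * phi y).
Hypotheses (phi1 : phi 1%g = 1) (phi_unip : forall x, cf (phi x) [::] = 1).
Implicit Types x y z : G.

Lemma cf_phiB1 x : cf (phi x - 1) [::] = 0.
Proof. by rewrite cfB phi_unip cf1 subrr. Qed.

Lemma phiM_B1 x y :
  phi (x * y)%g - 1 = (phi x - 1) + (phi y - 1) + (phi x - 1) * (phi y - 1).
Proof.
rewrite phiM mulrBl mul1r -addrA [_ - 1 + (_ - _)]addrC subrK mulrBr mulr1.
by rewrite addrC addrA subrK.
Qed.

Lemma phiV_B1 x : phi x^-1%g - 1 = - (phi x^-1%g * (phi x - 1)).
Proof. by rewrite mulrBr -phiM mulVg phi1 mulr1 opprB. Qed.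

Definition congruence (n : nat) x := above n (phi x - 1).

Lemma congruence1 n : congruence n 1%g.
Proof. by rewrite /congruence phi1 subrr; apply: above0. Qed.

Lemma congruenceM n x y : congruence n x -> congruence n y -> congruence n (x *
  y)%g.
Proof.
rewrite /congruence phiM_B1 => hx hy.
by apply: aboveD; [apply: aboveD | apply: above_mull].
Qed.

Lemma congruenceV n x : congruence n x -> congruence n x^-1%g.
Proof. by rewrite /congruence phiV_B1 => hx; apply/aboveN/above_mull. Qed.

Lemma congruenceX n x k : congruence n x -> congruence n (x ^+ k)%g.
Proof.
move=> hx; elim: k => [|k IHk]; first by rewrite expg0; apply: congruence1.
by rewrite expgS; apply: congruenceM.
Qed.

(** The product of the two increments is supported on words above [s], so on this congruence
    subgroup the coefficient at [s] is additive. *)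
Lemma cf_congruenceM s x y : congruence (code s) x -> congruence (code s) y ->
  cf (phi (x * y)%g - 1) s = cf (phi x - 1) s + cf (phi y - 1) s.
Proof.
move=> hx hy; rewrite phiM_B1 cfD [X in X + _]cfD.
by have [_ ->] := above_mul_small (cf_phiB1 x) hy; rewrite addr0.
Qed.

Lemma cf_congruenceV s x : congruence (code s) x ->
  cf (phi x^-1%g - 1) s = - cf (phi x - 1) s.
Proof.
move=> hx; apply/eqP; rewrite -addr_eq0 -cf_congruenceM //;
  last exact: congruenceV.
by rewrite mulVg phi1 subrr cf0.
Qed.

Lemma cf_congruenceX s x k : congruence (code s) x ->
  cf (phi (x ^+ k)%g - 1) s = cf (phi x - 1) s *+ k.
Proof.
move=> hx; elim: k => [|k IHk]; first by rewrite expg0 phi1 subrr cf0.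
by rewrite expgS cf_congruenceM ?IHk ?mulrS //; apply: congruenceX.
Qed.

(** With [a] and [b] the two increments, the commutator has increment
    [phi (y * x)^-1 * (a * b - b * a)]. The word [s ++ t] leads [a * b], only larger words occur in
    [b * a], and a factor with constant term 1 keeps the leading term. *)
Lemma leads_commutator s t x y :
    (size (s ++ t) <= D)%N -> (code (s ++ t) < code (t ++ s))%N ->
    leads s (phi x - 1) -> leads t (phi y - 1) ->
  leads (s ++ t) (phi [~ x, y]%g - 1).
Proof.
move=> stD lt_st [hx x1] [hy y1].
set a := phi x - 1 in hx x1 *; set b := phi y - 1 in hy y1 *.
have -> : phi [~ x, y]%g - 1 = phi (y * x)^-1%g * (a * b - b * a).
  have -> : a * b - b * a = phi (x * y)%g - phi (y * x)%g.
    by rewrite !phiM commutatorB1.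
  rewrite mulrBr -!phiM mulVg phi1; congr (phi _ - 1).
  by rewrite commgEl conjgE invMg !mulgA.
have hab : above (code (s ++ t)) (a * b - b * a).
  by apply: aboveD (aboveM hx hy) (aboveN _); apply: aboveW (aboveM hy hx);
    apply: ltnW.
have [h1 h2] := above_mul_unip (phi_unip (y * x)^-1%g) hab.
split=> //; rewrite h2 cfB cfM_lead // x1 y1 (aboveM hy hx) //.
by rewrite subr0 mulr1.
Qed.

End Unipotent.

(* The words that are iterated concatenations [u ++ v] with [u ++ v]
   lexicographically smaller than [v ++ u], i.e., the Lyndon words, with fuel
   [n]. The conditionals are nested to keep evaluation lazy. *)
Fixpoint lyndon (n : nat) (s : seq bool) : bool :=
  if n is n'.+1 then
    if size s is k.+2 then
      has (fun i => if lex_lt s (drop i s ++ take i s) then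
                      if lyndon n' (take i s) then lyndon n' (drop i s)
                      else false
                    else false) (iota 1 k.+1)
    else size s == 1%N
  else false.

Lemma natr_inj_pchar (R : nzRingType) p m n : p \in [pchar R] ->
  (m < p)%N -> (n < p)%N -> m%:R = n%:R :> R -> m = n.
Proof.
move=> pR; wlog le_mn : m n / (m <= n)%N => [W mp np eq_mn|mp np eq_mn].
  by case/orP: (leq_total m n) => le; [apply: W | apply/esym/W].
have := dvdn_pcharf pR (n - m); rewrite natrB // eq_mn subrr eqxx.
by have [|lt_mn /dvdn_leq] := posnP (n - m); lia.
Qed.

Section Products.
Variables (K : fieldType) (D : nat).
Local Notation A := (truncated_series K D).
Variables (G : groupType) (phi : G -> A).
Hypotheses (phiM : forall x y, phi (x * y)%g = phi x * phi y).
Hypotheses (phi1 : phi 1%g = 1) (phi_unip : forall x, cf (phi x) [::] = 1).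
Implicit Types (x y z : G) (s t w : seq bool).

(** Letters come from the two generators, and a split of a longer word from the commutator of the
    elements found for its two parts. *)
Lemma lyndon_leads (g : bool -> G) n s :
    (forall b, phi (g b) = 1 + word K D [:: b]) ->
    lyndon n s -> (size s <= D)%N ->
  exists2 z, leads s (phi z - 1) &
    (1 < size s)%N -> smallest (@subgroup G) (@commutators G) z.
Proof.
move=> phi_g; elim: n s => [|n IHn] //= s.
case Es: (size s) => [|[|k]] //= => [_ D0|Hs kD].
  case: s Es => [|b [|c s]] //= _; exists (g b) => //.
  rewrite phi_g addrC addKr; split=> [t|]; last by rewrite cf_word eqxx D0.
  by rewrite cf_word; case: eqP => [->|_ _]; rewrite ?ltnn ?andbF.
have {Hs} /hasP[i] : has (fun i => if lex_lt s (drop i s ++ take i s) then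
      if lyndon n (take i s) then lyndon n (drop i s) else false else false)
    (iota 1 k.+1) by [].
rewrite mem_iota => /andP[i0 ik]; case: ifP => // lt_s; case: ifP => // Lu Lv.
have [x x_lead _] := IHn _ Lu ltac:(rewrite size_take_min Es; lia).
have [y y_lead _] := IHn _ Lv ltac:(rewrite size_drop Es; lia).
exists [~ x, y]%g; last by move=> _ B [_]; apply; exists x => //;
  exists y => //.
rewrite -(cat_take_drop i s); apply: leads_commutator => //.
  by rewrite cat_take_drop Es.
by apply: lex_lt_code; [rewrite !size_cat addnC | rewrite cat_take_drop].
Qed.

Variable S : set A.
Hypothesis S_normal : normal_subgroup (fun x => S (phi x - 1)).
Variables (p : nat) (z : seq bool -> G).
Hypothesis pK : p \in [pchar K].

Fixpoint word_product (ws : seq (seq bool)) (e : seq bool -> nat) : G :=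
  if ws is w :: ws' then (z w ^+ e w * word_product ws' e)%g else 1%g.

(** Induction from the smallest word [w]: modulo larger words, a conjugate of the quotient has
    coefficient [e w - e' w] at [w]. This vanishes as [w] leads nothing in [S], and exponents below
    [p] are determined modulo [p]. *)
Lemma word_product_inj ws e e' :
    sorted (relpre code ltn) ws ->
    (forall w, w \in ws -> [/\ leads w (phi (z w) - 1), (e w < p)%N, (e' w <
      p)%N
      & forall a, S a -> above (code w) a -> cf a w = 0]) ->
    S (phi (word_product ws e * (word_product ws e')^-1)%g - 1) ->
  {in ws, e =1 e'}.
Proof.
have [[_ SV] SJ] := S_normal.
have cong_prod n us f : all (fun w => n <= code w)%N us ->
    (forall w, w \in us -> leads w (phi (z w) - 1)) ->
    congruence phi n (word_product us f).
  elim: us => [|w us IHus] /=; first by move=> _ _; apply: congruence1.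
  move=> /andP[nw nus] h; apply: congruenceM => //.
    by apply: congruenceX => //; apply: aboveW nw (h w _).1; rewrite mem_head.
  by apply: IHus => // v vus; apply: h; rewrite inE vus orbT.
elim: ws => [|w ws IHws] //= w_ws h.
have [[hw w1] ep e'p noS] := h w (mem_head _ _).
have hws v : v \in ws -> _ := fun vws => h v (mem_behead (s := w :: ws) vws).
set P := word_product ws e; set P' := word_product ws e' => SPP'.
have w_lt : all (fun v => (code w).+1 <= code v)%N ws.
  by have := order_path_min (fun _ _ _ => @ltn_trans _ _ _) w_ws.
have cP : congruence phi (code w).+1 P by apply: cong_prod => // v /hws[].
have cP' : congruence phi (code w).+1 P' by apply: cong_prod => // v /hws[].
set Q := (P * P'^-1)%g.
have cQ : congruence phi (code w).+1 Q.
  by apply: congruenceM => //; apply: congruenceV.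
have cQw : congruence phi (code w) Q by apply: aboveW cQ.
(* Conjugating by [z w ^+ e' w] moves the last factor to the front, next to [z w ^+ e w], so that
   the two cancel once the exponents agree. *)
have SQ : S (phi ((z w ^+ e' w)^-1 * (z w ^+ e w * Q))%g - 1).
  have := SJ _ (z w ^+ e' w)%g SPP'; rewrite invMg !mulgA.
  by rewrite -!mulgA mulVg mulg1 /Q !mulgA.
have cX k : congruence phi (code w) (z w ^+ k)%g by apply: congruenceX.
have cV : congruence phi (code w) (z w ^+ e' w)^-1%g by apply: congruenceV.
have cXQ : congruence phi (code w) (z w ^+ e w * Q)%g by apply: congruenceM.
have /eqP : cf (phi ((z w ^+ e' w)^-1 * (z w ^+ e w * Q))%g - 1) w = 0.
  by apply: noS => //; apply: (congruenceM phiM).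
rewrite cf_congruenceM // (@cf_congruenceM _ _ _ _ _ _ _ _ Q) //.
rewrite cf_congruenceV // !cf_congruenceX // w1 (cQ w (leqnn _)) addr0 addrC.
rewrite subr_eq0 => /eqP eq_nat.
have eq_e : e w = e' w by exact: (natr_inj_pchar pK ep e'p eq_nat).
move=> v; rewrite inE => /predU1P[->//|vws]; apply: IHws v vws => //.
  exact: path_sorted w_ws.
by move: SQ; rewrite eq_e mulKg.
Qed.

End Products.

Lemma sorted_strict_sort (T : eqType) (f : T -> nat) (s : seq T) :
  injective f -> uniq s ->
  sorted (relpre f ltn) (sort (relpre f leq) s).
Proof.
move=> f_inj s_uniq; rewrite -sorted_map ltn_sorted_uniq_leq sorted_map.
by rewrite map_inj_uniq // sort_uniq s_uniq sort_sorted // => x y;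
  apply: leq_total.
Qed.

(** * Counting the leading words of a subspace *)

Section Words.
Local Open Scope nat_scope.

Fixpoint words (n : nat) : seq (seq bool) :=
  [::] :: if n is n'.+1 then
            map (cons false) (words n') ++ map (cons true) (words n')
          else [::].

Lemma mem_words n s : (s \in words n) = (size s <= n).
Proof.
elim: n s => [|n IHn] [|b s] //=; rewrite inE /= mem_cat.
have cons_inj (c : bool) : injective (cons c) by move=> ? ? [].
have neq (c : bool) : ((c :: s) \in map (cons (~~ c)) (words n)) = false.
  by apply/mapP=> -[t _ []]; case: c.
by case: b; rewrite (mem_map (cons_inj _)) (neq true, neq false) ?orbF IHn.
Qed.

Lemma words_uniq n : uniq (words n).
Proof.
have cons_inj (c : bool) : injective (cons c) by move=> ? ? [].
elim: n => //= n IHn; rewrite mem_cat negb_or cat_uniq !map_inj_uniq // IHn.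
rewrite andbT; apply/andP; split; first by apply/andP; split; apply/mapP=> -[].
by apply/hasPn=> _ /mapP[t _ ->]; apply/mapP=> -[].
Qed.

(** Trades cardinals of sets of bounded words for counts in an explicit list, which can be
    evaluated. *)
Lemma card_words n (P : pred (seq bool)) :
  #|[set w : {bseq n of bool} | P w]| = count P (words n).
Proof.
have /seq.permP <- : perm_eq (map val (enum {bseq n of bool})) (words n).
  apply: uniq_perm; [|exact: words_uniq|].
    by rewrite map_inj_uniq ?enum_uniq //; apply: val_inj.
  move=> s; rewrite mem_words; apply/mapP/idP => [[w _ ->]|sn].
    exact: size_bseq.
  by exists (Bseq sn); rewrite ?mem_enum.
rewrite count_map cardsE cardE size_filter enumT.
exact: eq_count.
Qed.

End Words.

Section LeadingWords.
Variables (K : finFieldType) (D : nat).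
Local Notation A := (truncated_series K D).
Local Notation W := {bseq D of bool}.
Implicit Types (a b : A) (V : {vspace A}) (w : W).

Definition leading_words V : {set W} :=
  [set w : W | `[< exists2 a, a \in V & above (code w) a /\ cf a w != 0 >]]%SET.

Lemma cf_span (X : seq A) s a :
  (forall x, x \in X -> cf x s = 0) -> a \in <<X>>%VS -> cf a s = 0.
Proof.
move=> X0 aX; rewrite (coord_span (X := in_tuple X) aX) cf_sum big1 // => i _.
by rewrite cfZ X0 ?mulr0 // mem_nth.
Qed.

(** Elements with distinct leading words are free: in increasing order, the first has a nonzero
    coefficient at a word where all later ones vanish. *)
Lemma dim_leading_words V : (#|leading_words V| <= \dim V)%N.
Proof.
pose f w : A := odflt 0 [pick a : A | (a \in V) && `[< above (code w) a /\ cf a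
  w != 0 >]].
have fP w : w \in leading_words V -> [/\ f w \in V, above (code w) (f w) & cf (f
  w) w != 0].
  rewrite inE => /asboolP[a aV ha]; rewrite /f;
    case: pickP => [b /andP[? /asboolP[]]//|/(_ a)].
  by rewrite aV asboolT.
pose L := sort (relpre (fun w : W => code w) leq) (enum (leading_words V)).
have L_sorted : sorted (relpre (fun w : W => code w) ltn) L.
  by apply: sorted_strict_sort (enum_uniq _) => v w /code_inj/val_inj.
have LP w : w \in L -> w \in leading_words V by rewrite mem_sort mem_enum.
have free_L : free (map f L).
  elim: L L_sorted LP => [|w L IHL] /=; first by rewrite nil_free.
  move=> wL LP; rewrite free_cons IHL ?(path_sorted wL) // ?andbT; last first.
    by move=> v vL; apply: LP; rewrite inE vL orbT.
  have [_ _] := fP w (LP w (mem_head _ _)); apply: contra => /cf_span -> //.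
  move=> _ /mapP[v vL ->]; have [_ + _] := fP v (LP v (mem_behead (s := w :: L)
    vL)).
  apply; have w_lt : all (relpre (fun w : W => code w) ltn w) L.
    by apply: (order_path_min _ wL) => ? ? ?; apply: ltn_trans.
  exact: (allP w_lt).
have := free_L; rewrite /free size_map size_sort -cardE => /eqP <-.
by apply/dimvS/span_subvP => _ /mapP[w /LP wL ->]; have [] := fP w wL.
Qed.

(** [E] collects words already known to lead elements of [V]. The dimension allows at most [m] other
    leading words, so at least [N] words of [L] outside [E] lead nothing in [V]. *)
Lemma enough_words V (E L : pred (seq bool)) m N :
    (forall w : W, E w -> w \in leading_words V) ->
    (\dim V <= count E (words D) + m)%N ->
    (N + m <= count (predD L E) (words D))%N ->
  exists ws : seq (seq bool), [/\ sorted (relpre code ltn) ws, size ws = N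
    & forall w : seq bool, w \in ws -> [/\ L w, (size w <= D)%N
        & forall a, a \in V -> above (code w) a -> cf a w = 0]].
Proof.
move=> EV dimV NL.
pose S := [set w : W | L w && (w \notin leading_words V)]%SET.
have le_S : (N <= #|S|)%N.
  pose B := (leading_words V :\: [set w : W | E w])%SET.
  have leB : (#|B| <= m)%N.
    have := cardsID [set w : W | E w]%SET (leading_words V).
    rewrite (finset.setIidPr _); last by apply/fintype.subsetP=> w;
      rewrite inE => /EV.
    rewrite card_words => eq_card; rewrite -(leq_add2l (count E (words D)))
      eq_card.
    exact: leq_trans (dim_leading_words V) dimV.
  have : ([set w : W | predD L E w] \subset S :|: B)%SET.
    apply/fintype.subsetP=> w; rewrite !inE /= => /andP[-> ->] /=.
    by rewrite orNb.
  move/subset_leq_card; rewrite card_words => /leq_trans/(_ (leq_card_setU _ _))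
    h.
  rewrite -(leq_add2r m); apply: leq_trans NL (leq_trans h _).
  by rewrite leq_add2l.
pose ws := sort (relpre code leq) (map val (enum S)).
have ws_sorted : sorted (relpre code ltn) ws.
  by apply: (sorted_strict_sort code_inj); rewrite map_inj_uniq ?enum_uniq //;
    apply: val_inj.
exists (take N ws); split.
- by apply: take_sorted.
- by rewrite size_takel // size_sort size_map -cardE.
move=> w /mem_take; rewrite mem_sort => /mapP[v + ->]; rewrite mem_enum inE.
move=> /andP[Lv vV]; split=> //; first exact: size_bseq.
move=> a aV av; apply/eqP; apply: contraNT vV => a0; rewrite inE.
by apply/asboolP; exists a.
Qed.

End LeadingWords.

(** * The subspace of relations *)

Section PrincipalIdeal.
Variables (K : fieldType) (D : nat).
Local Notation A := (truncated_series K D).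
Implicit Types (a b : A) (s t u v w : seq bool).

Lemma word_gtD s : (D < size s)%N -> word K D s = 0.
Proof.
move=> sD; apply/cfP=> t tD; rewrite cf_word cf0.
by case: eqP tD => [->|_ _]; rewrite ?andbF // leqNgt sD.
Qed.

Lemma leads_word s : (size s <= D)%N -> leads s (word K D s).
Proof.
move=> sD; split=> [t|]; last by rewrite cf_word sD eqxx.
by rewrite cf_word; case: eqP => [->|]; rewrite ?ltnn ?andbF.
Qed.

Lemma order_ge_word s : order_ge (size s) (word K D s).
Proof.
by move=> t; rewrite cf_word; case: eqP => [->|_ _]; rewrite ?ltnn ?andbF.
Qed.

Lemma memv_expand (V : {vspace A}) a :
  (forall s, (size s <= D)%N -> cf a s != 0 -> word K D s \in V) -> a \in V.
Proof.
move=> aV; rewrite (series_expand a); apply: memv_suml => w _.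
have [->|a0] := eqVneq (cf a w) 0; first by rewrite scale0r mem0v.
by apply/memvZ/aV; rewrite ?size_bseq.
Qed.

Lemma code_cat3_lt u s t v : (code s < code t)%N ->
  (code (u ++ s ++ v) < code (u ++ t ++ v))%N.
Proof.
move=> lt_st; rewrite ltnNge; apply/negP => le.
have [h1 h2] : t ++ v = s ++ v /\ u = u.
  have le_st : (code (s ++ v) <= code (t ++ v))%N.
    by have := code_cat s v; have := code_cat t v; nia.
  by have [] := code_cat_le (leqnn (code u)) le_st le.
move: h1 => /(congr1 (fun w => code w + 2 ^ size v)%N); rewrite !code_cat.
by have := expn_gt0 2 (size v); nia.
Qed.

Variables (r : A) (l : seq bool).
Hypotheses (lD : (size l <= D)%N) (r_above : above (code l) r) (rl : cf r l !=
  0).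
Hypothesis l_gt0 : (0 < size l)%N.

(** The pairs stand for words [u ++ l ++ v], cut at an occurrence of [l] with none inside [v]. If
    [l] does not overlap itself, each word of length at most [D] containing [l] arises from exactly
    one pair. *)
Definition ideal_pairs :=
  [seq (u, v) | u <- words (D - size l),
                v <- [seq v <- words (D - size l - size u) | ~~ infix l v]].

Definition principal_ideal : {vspace A} :=
  <<[seq word K D uv.1 * r * word K D uv.2 | uv <- ideal_pairs]>>%VS.

Lemma generator_order : order_ge (size l) r.
Proof.
move=> s sl; apply: r_above; exact: size_code.
Qed.

(* If [v] contains [l], one occurrence is rewritten using [r], which
   either lengthens the left factor or increases [v]. *)
Lemma principal_ideal_words u v : word K D u * r * word K D v \in
  principal_ideal.
Proof.
have [n] := ubnP (D.+1 - size u); elim: n => // n IHn in u v *;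
  rewrite ltnS => un.
have {IHn} IHn u' v' : (size u < size u')%N -> word K D u' * r * word K D v' \in
  principal_ideal.
  move=> uu'; have [uD|Du] := leqP (size u) D; last first.
    by rewrite word_gtD ?mul0r ?mem0v //; lia.
  by apply: IHn; lia.
have [m] := ubnP (2 ^ D.+1 - code v); elim: m => // m IHm in v *;
  rewrite ltnS => vm.
have [Dv|vD] := ltnP D (size v); first by rewrite (word_gtD Dv) mulr0 mem0v.
have [big|small] := ltnP D (size u + size l + size v).
  suff -> : word K D u * r * word K D v = 0 by rewrite mem0v.
  apply: (@order_ge_eq0 _ _ (size u + size l + size v)) => //.
  exact: order_geM (order_geM (@order_ge_word _) generator_order)
    (@order_ge_word _).
have [/infixP[v1 [v2 def_v]]|vl] := boolP (infix l v); last first.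
  apply: memv_span; apply/mapP; exists (u, v) => //=.
  apply/allpairsPdep; exists u; exists v; split=> //.
    by rewrite mem_words; move: (size u) (size l) (size v) small => *; lia.
  rewrite mem_filter vl mem_words /=.
  by move: (size u) (size l) (size v) small => *; lia.
(* Up to a scalar, the factor [l] of [v] is traded for [r] minus the part of [r] above [l]. *)
have -> : word K D v = (cf r l)^-1 *:
    (word K D v1 * r * word K D v2 - word K D v1 * (r - cf r l *: word K D l) *
      word K D v2).
  rewrite mulrBr mulrBl opprB addrC subrK -scalerAr -scalerAl scalerA mulVf //
    scale1r.
  by rewrite !wordM def_v -catA.
rewrite -scalerAr memvZ // mulrBr memvB //.
  (* The order of [a] exceeds the length of [u], so the outer induction applies to its words. *)
  rewrite !mulrA; set a := word K D u * r * word K D v1.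
  rewrite (series_expand a) !mulr_suml; apply: memv_suml => w _.
  rewrite -!scalerAl; have [wu|uw] := leqP (size w) (size u);
    last exact/memvZ/IHn.
  suff -> : cf a w = 0 by rewrite scale0r mem0v.
  have : order_ge (size u + size l + size v1) a.
    exact: order_geM (order_geM (@order_ge_word _) generator_order)
      (@order_ge_word _).
  by apply; move: (size u) (size l) l_gt0 (size w) wu => *; lia.
(* Only words [w] above [l] occur in [b], and then [v1 ++ w ++ v2] is above [v]: the inner induction
   applies. *)
set b := r - _; rewrite (series_expand b) mulr_sumr mulr_suml mulr_sumr.
apply: memv_suml => w _; rewrite -scalerAr -scalerAl -scalerAr !wordM -catA.
have [le_w|lt_w] := leqP (code w) (code l).
  suff -> : cf b w = 0 by rewrite scale0r mem0v.
  rewrite cfB cfZ cf_word size_bseq /=; move: le_w; rewrite leq_eqVlt.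
  case/predU1P=> [/code_inj ->|lt_w]; first by rewrite eqxx mulr1 subrr.
  by rewrite r_above //; case: eqP lt_w => [->|_ _];
    rewrite ?ltnn // mulr0 subr0.
apply/memvZ/IHm; have := code_cat3_lt v1 v2 lt_w; rewrite -def_v => lt_v.
have /andP[_ v_lt] := code_bounds v.
have v_lt' : (code v < 2 ^ D.+1)%N by apply: leq_trans v_lt _;
  rewrite leq_exp2l.
apply: leq_trans vm; exact: ltn_sub2l.
Qed.

Lemma principal_idealP a b : a * r * b \in principal_ideal.
Proof.
rewrite (series_expand a) (series_expand b) !mulr_suml; apply: memv_suml => u _.
rewrite mulr_sumr; apply: memv_suml => v _.
by rewrite -scalerAr -!scalerAl !memvZ // principal_ideal_words.
Qed.

Lemma principal_idealM a b c :
  b \in principal_ideal -> a * b * c \in principal_ideal.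
Proof.
move=> bT; rewrite (coord_span (X := in_tuple _) bT) mulr_sumr mulr_suml.
apply: memv_suml => i _; rewrite -scalerAr -scalerAl memvZ //.
set x := _`_i; have /mapP[uv _ ->] : x \in [seq word K D uv.1 * r * word K D
  uv.2 | uv <- ideal_pairs].
  by rewrite mem_nth.
by rewrite !mulrA -[_ * word K D uv.2 * c]mulrA principal_idealP.
Qed.

Lemma principal_ideal_lead w : (size w <= D)%N -> infix l w ->
  exists2 a, a \in principal_ideal & above (code w) a /\ cf a w != 0.
Proof.
move=> wD /infixP[u [v def_w]]; exists (word K D u * r * word K D v).
  exact: principal_ideal_words.
rewrite def_w catA in wD *.
have uD : (size u <= D)%N.
  by apply: leq_trans wD; rewrite !size_cat -addnA leq_addr.
have vD : (size v <= D)%N by apply: leq_trans wD; rewrite !size_cat leq_addl.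
have [hu cu] := leads_word uD; have [hv cv] := leads_word vD.
have hur := aboveM hu r_above.
split; first exact: aboveM.
have ulD : (size (u ++ l) <= D)%N.
  by apply: leq_trans wD; rewrite [in X in (_ <= X)%N]size_cat leq_addr.
by rewrite cfM_lead // cfM_lead // cu cv mul1r mulr1.
Qed.

Lemma dim_principal_ideal : (\dim principal_ideal <= size ideal_pairs)%N.
Proof. by apply: leq_trans (dim_span _) _; rewrite size_map. Qed.

End PrincipalIdeal.

(** * Brackets, conjugation by the generators and shuffle relations *)

Section Brackets.
Variables (K : finFieldType) (D : nat).
Local Notation A := (truncated_series K D).
Implicit Types (a b c q u : A) (s w : seq bool).

Lemma cf_nilM a b : cf (a * b) [::] = cf a [::] * cf b [::].
Proof. by rewrite cfM // big_ord1. Qed.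

Lemma order_ge1 a : cf a [::] = 0 -> order_ge 1 a.
Proof. by move=> a0 []. Qed.

Lemma order_geX n a : order_ge 1 a -> order_ge n (a ^+ n).
Proof.
move=> a1; elim: n => [|n IHn]; first by [].
by rewrite exprS; apply: (order_geM a1 IHn).
Qed.

(** As [1 - u] is nilpotent, the geometric series inverts [u]. *)
Lemma unipotent_unit u : cf u [::] = 1 -> u \is a GRing.unit.
Proof.
move=> u1; have b1 : order_ge 1 (1 - u) by apply: order_ge1;
  rewrite cfB cf1 u1 subrr.
have bD : (1 - u) ^+ D.+1 = 0 by apply: order_ge_eq0 (order_geX b1).
set S := \sum_(i < D.+1) (1 - u) ^+ i.
have uS : u * S = 1.
  have := subrX1 (1 - u) D.+1; rewrite bD sub0r addrAC subrr add0r mulNr.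
  by move/oppr_inj.
have Su : S * u = 1.
  have cSu : GRing.comm u S.
    apply: commr_sum => i _; apply: commrX; apply: commrB => //; exact: commr1.
  by rewrite -cSu.
by apply/unitrP; exists S.
Qed.

Lemma cf_unipV u : cf u [::] = 1 -> cf u^-1 [::] = 1.
Proof.
move=> u1; have := cf_nilM u^-1 u; rewrite mulVr ?unipotent_unit // u1 mulr1.
by rewrite cf1 eqxx.
Qed.

Definition gen (x : bool) : A := 1 + word K D [:: x].

Lemma cf_gen x : cf (gen x) [::] = 1.
Proof. by rewrite cfD cf1 cf_word andbF addr0. Qed.

(* Locked, so that unification does not see a difference in a bracket. *)
Definition bracket a b := locked (a * b - b * a).

Lemma bracketE a b : bracket a b = a * b - b * a.
Proof. by rewrite /bracket -lock. Qed.

Lemma bracketBl a b c : bracket (a - b) c = bracket a c - bracket b c.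
Proof. by rewrite !bracketE mulrBl mulrBr; apply/cfP=> s _; rewrite !cfB;
  ring. Qed.

Lemma bracketDr a b c : bracket a (b + c) = bracket a b + bracket a c.
Proof. by rewrite !bracketE mulrDl mulrDr; apply/cfP=> s _;
  rewrite !(cfB, cfD); ring. Qed.

Lemma bracketZr (k : K) a b : bracket a (k *: b) = k *: bracket a b.
Proof. by rewrite !bracketE -scalerAl -scalerAr scalerBr. Qed.

Lemma bracket_jacobi q a b : bracket q (bracket a b) = bracket (bracket q a) b -
  bracket (bracket q b) a.
Proof.
rewrite !bracketE !(mulrBl, mulrBr) !mulrA.
by apply/cfP=> s _; rewrite !cfB; ring.
Qed.

Lemma order_ge_bracket m n a b : order_ge m a -> order_ge n b -> order_ge (m +
  n) (bracket a b).
Proof.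
move=> ha hb; rewrite bracketE; apply: order_geD; first exact: order_geM.
by apply: order_geN; rewrite addnC; apply: order_geM.
Qed.

Lemma order_ge_letter x : order_ge 1 (word K D [:: x]).
Proof. exact: (@order_ge_word _ _ [:: x]). Qed.

(** Unlike conjugation, this operator raises the order by one; to lowest order it is the bracket
    with the letter [x]. *)
Definition conj_sub (x : bool) q := (gen x)^-1 * q * gen x - q.

Lemma conj_subE x q : conj_sub x q = (gen x)^-1 * bracket q (word K D [:: x]).
Proof.
have -> : bracket q (word K D [:: x]) = q * gen x - gen x * q.
  by rewrite !bracketE mulrDr mulrDl mulr1 mul1r opprD addrACA subrr add0r.
by rewrite mulrBr !mulrA mulVr ?unipotent_unit ?cf_gen // mul1r.
Qed.

Lemma order_ge_conj_sub n x q : order_ge n q -> order_ge n.+1 (conj_sub x q).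
Proof.
move=> hq; rewrite conj_subE -[n.+1]add0n; apply: order_geM => //.
by rewrite -[n.+1]addn1; apply: order_ge_bracket hq _; apply: order_ge_letter.
Qed.

Lemma order_ge_conj_sub_bracket n x q :
  order_ge n q -> order_ge n.+2 (conj_sub x q - bracket q (word K D [:: x])).
Proof.
move=> hq; rewrite conj_subE -{2}[bracket _ _]mul1r -mulrBl -[n.+2]add1n;
  apply: order_geM.
  by apply: order_ge1; rewrite cfB cf1 cf_unipV ?cf_gen ?subrr.
by rewrite -[n.+1]addn1; apply: order_ge_bracket hq _; apply: order_ge_letter.
Qed.

Definition conj_sub_word w q := foldl (fun q x => conj_sub x q) q w.

Lemma conj_sub_word_rcons w x q : conj_sub_word (rcons w x) q = conj_sub x
  (conj_sub_word w q).
Proof. by rewrite /conj_sub_word -cats1 foldl_cat. Qed.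

Lemma order_ge_conj_sub_word n w q : order_ge n q -> order_ge (n + size w)
  (conj_sub_word w q).
Proof.
move=> hq; elim/last_ind: w => [|w x IHw]; first by rewrite addn0.
by rewrite conj_sub_word_rcons size_rcons addnS; apply: order_ge_conj_sub.
Qed.

(** Each of the three replacements of [conj_sub] by a bracket costs an error of order [n + 4], which
    is beyond [D]. *)
Lemma conj_sub_word3E n x y z q : (D < n + 4)%N -> order_ge n q ->
  conj_sub_word [:: x; y; z] q =
  bracket (bracket (bracket q (word K D [:: x])) (word K D [:: y])) (word K D
    [:: z]).
Proof.
move=> Dn hq; have w1 t : order_ge 1 (word K D [:: t]) by apply:
  order_ge_letter.
have h1 := order_ge_conj_sub_bracket x hq.
have h2 := order_ge_conj_sub_bracket y (order_ge_conj_sub x hq).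
have h3 := order_ge_conj_sub_bracket z (order_ge_conj_sub y (order_ge_conj_sub x
  hq)).
have eq0 a b m : (D < m)%N -> order_ge m (a - b) -> a = b.
  by move=> Dm /(order_ge_eq0 Dm)/eqP; rewrite subr_eq0 => /eqP.
transitivity (bracket (conj_sub_word [:: x; y] q) (word K D [:: z])).
  by apply: eq0 h3; move: Dn; rewrite addn4.
transitivity (bracket (bracket (conj_sub x q) (word K D [:: y])) (word K D [::
  z])).
  apply: (eq0 _ _ (n.+3 + 1)%N); first by move: Dn; rewrite addn4 addn1.
  rewrite -(bracketBl (conj_sub_word [:: x; y] q) (bracket (conj_sub x q) _)).
  exact: (order_ge_bracket h2 (w1 z)).
apply: (eq0 _ _ (n.+2 + 1 + 1)%N); first by move: Dn; rewrite addn4 !addn1.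
by rewrite -!bracketBl; apply: order_ge_bracket => //; apply: order_ge_bracket.
Qed.

(** The general Lie element of degree 3 in two letters; [k] and [m] are its coefficients at xxy and
    xyy. *)
Definition lie3 (k m : K) : A :=
  k *: bracket (word K D [:: false]) (bracket (word K D [:: false]) (word K D
    [:: true])) +
  m *: bracket (bracket (word K D [:: false]) (word K D [:: true])) (word K D
    [:: true]).

(** Only the degree 3 part of [r] acts on [q], and the Jacobi identity expands its action into
    iterated brackets by letters. Modulo the ideal of [r] the left side vanishes, which gives a
    linear relation between the [conj_sub_word w q] with [w] of length 3. *)
Lemma bracket_lie3 n k m q r : (D < n + 4)%N -> order_ge n q ->
    order_ge 4 (r - lie3 k m) ->
  bracket q r =
    k *: (conj_sub_word [:: false; false; true] q - conj_sub_word [:: false;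
      true; false] q
          - (conj_sub_word [:: false; true; false] q - conj_sub_word [:: true;
            false; false] q)) +
    m *: (conj_sub_word [:: false; true; true] q - conj_sub_word [:: true;
      false; true] q
          - (conj_sub_word [:: true; false; true] q - conj_sub_word [:: true;
            true; false] q)).
Proof.
move=> Dn hq hr; transitivity (bracket q (lie3 k m)).
  have h : bracket q (r - lie3 k m) = 0 by apply: (order_ge_eq0 Dn);
    apply: order_ge_bracket.
  by rewrite -{1}(subrK (lie3 k m) r) bracketDr h add0r.
have E x y z := conj_sub_word3E x y z Dn hq;
  rewrite !E /lie3 bracketDr !bracketZr {E}.
set X := word K D [:: false]; set Y := word K D [:: true].
rewrite (bracket_jacobi q X (bracket X Y)) (bracket_jacobi (bracket q X) X Y).
rewrite (bracket_jacobi q (bracket X Y) Y) (bracket_jacobi (bracket q Y) X Y)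
  (bracket_jacobi q X Y).
by rewrite (bracketBl (bracket (bracket q X) Y) _ X) (bracketBl (bracket
  (bracket q X) Y) _ Y).
Qed.

(* The coefficients of the elements of the group generated by the [gen x]
   obey the Chen-Fox-Lyndon shuffle relations. *)
Definition shuffle_relations u := 
  (forall a b : bool, cf u [:: a] * cf u [:: b] =
     cf u [:: a; b] + cf u [:: b; a] + (a == b)%:R * cf u [:: a]) /\
  (forall a b c : bool, cf u [:: a] * cf u [:: b; c] =
     cf u [:: a; b; c] + cf u [:: b; a; c] + cf u [:: b; c; a] +
     ((a == b)%:R + (a == c)%:R) * cf u [:: b; c]).

Lemma shuffle_relations1 : shuffle_relations 1.
Proof. by split=> *; rewrite !cf1 /=; ring. Qed.

Hypothesis D_ge3 : (3 <= D)%N.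

Lemma shuffle_relations_gen x : shuffle_relations (gen x).
Proof.
have D1 : (1 <= D)%N by apply: leq_trans D_ge3.
split=> [a b|a b c]; rewrite /gen !cfD !cf1 !cf_word /= ?D1 ?eqseq_cons ?andbF
  ?andbT /=; last first.
  by ring.
by case: a; case: b; case: x; rewrite /=; ring.
Qed.

(** The relations say that taking coefficients is multiplicative for the infiltration product of a
    letter with a word of length 1 or 2. *)
Lemma shuffle_relationsM u v : cf u [::] = 1 -> cf v [::] = 1 ->
  shuffle_relations u -> shuffle_relations v -> shuffle_relations (u * v).
Proof.
move=> u1 v1 [u2 u3] [v2 v3].
have D1 : (1 <= D)%N by apply: leq_trans D_ge3.
have D2 : (2 <= D)%N by apply: leq_trans D_ge3.
have E1 (a : bool) : cf (u * v) [:: a] = cf u [:: a] + cf v [:: a].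
  by rewrite cfM // !big_ord_recl big_ord0 /= u1 v1; ring.
have E2 (a b : bool) : cf (u * v) [:: a; b] = cf u [:: a;
  b] + cf u [:: a] * cf v [:: b] + cf v [:: a; b].
  by rewrite cfM // !big_ord_recl big_ord0 /= u1 v1; ring.
have E3 (a b c : bool) : cf (u * v) [:: a; b; c] = cf u [:: a; b;
  c] + cf u [:: a; b] * cf v [:: c]
    + cf u [:: a] * cf v [:: b; c] + cf v [:: a; b; c].
  by rewrite cfM // !big_ord_recl big_ord0 /= u1 v1; ring.
split=> [a b|a b c].
  by rewrite !E1 !E2 mulrDl !mulrDr u2 v2; ring.
rewrite !E1 !E2 !E3.
(* The correction terms vanish unless the two letters agree, so the letter may be renamed. *)
have Hu : (a == b)%:R * cf u [:: a] = (a == b)%:R * cf u [:: b].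
  by case: eqP => [->|]; rewrite ?mul0r.
have Hv : (a == c)%:R * cf v [:: a] = (a == c)%:R * cf v [:: c].
  by case: eqP => [->|]; rewrite ?mul0r.
transitivity (cf u [:: a] * cf u [:: b; c] + cf u [:: a] * cf u [:: b] * cf v
  [:: c]
   + cf u [:: a] * cf v [:: b; c] + cf v [:: a] * cf u [:: b; c]
   + cf u [:: b] * (cf v [:: a] * cf v [:: c]) + cf v [:: a] * cf v [:: b; c]);
     first by ring.
by rewrite u3 v3 u2 v2 Hu Hv; ring.
Qed.

(** Without terms of degree 1 and 2 the relations become homogeneous in degree 3. Dividing by 3
    kills the coefficients of cubes, and dividing by 2 helps to express the others by those at xxy
    and xyy. *)
Lemma shuffle_relations_lie3 u : shuffle_relations u -> order_ge 3 (u - 1) ->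
    2%:R != 0 :> K -> 3%:R != 0 :> K ->
  order_ge 4 (u - 1 - lie3 (cf u [:: false; false; true]) (cf u [:: false;
    true; true])).
Proof.
move=> [_ u3] hu K2 K3.
have low s : (0 < size s < 3)%N -> cf u s = 0.
  by move=> /andP[s0 s3]; have := hu s s3; rewrite cfB cf1;
    case: s s0 {s3} => //= x s _; rewrite subr0.
have rel (a b c : bool) : cf u [:: a; b; c] + cf u [:: b; a; c] + cf u [:: b;
  c; a] = 0.
  by have := u3 a b c; rewrite (low [:: a]) // (low [:: b;
    c]) // mul0r mulr0 addr0 => <-.
have w1 t : order_ge 1 (word K D [:: t]) by apply: order_ge_letter.
have h3 : order_ge 3 (lie3 (cf u [:: false; false; true]) (cf u [:: false;
  true; true])).
  apply: order_geD; apply: order_geZ.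
    exact: (order_ge_bracket (w1 _) (order_ge_bracket (w1 _) (w1 _))).
  exact: (order_ge_bracket (order_ge_bracket (w1 _) (w1 _)) (w1 _)).
move=> s; rewrite ltnS leq_eqVlt => /orP[/eqP s3|s3]; last first.
  by rewrite cfB hu // h3 // subrr.
have xxx (t : bool) : cf u [:: t; t; t] = 0.
  apply/eqP; have := rel t t t; rewrite -mulr2n -mulrSr => /eqP.
  by rewrite -mulr_natl mulf_eq0 (negbTE K3).
have xyx (a b : bool) : cf u [:: a; b; a] = - (2%:R * cf u [:: a; a; b]).
  by apply/eqP; rewrite -addr_eq0 -(rel a a b); apply/eqP; ring.
have yxx (a b : bool) : cf u [:: b; a; a] = cf u [:: a; a; b].
  apply: (mulfI K2); have := rel a b a; rewrite xyx => /eqP.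
  by rewrite -addrA addrC subr_eq0 => /eqP <-; ring.
case: s s3 => [|a [|b [|c [|? ?]]]] // _.
rewrite cfB cfB cf1 /lie3 !bracketE cfD !cfZ !(mulrBl, mulrBr) !mulrA !wordM /=
  !cfB !cf_word /= D_ge3.
case: a; case: b; case: c; rewrite ?eqseq_cons /= ?xxx ?(xyx false true)
  ?(xyx true false) ?(yxx false true) -?(yxx true false); ring.
Qed.

End Brackets.

(** Single letters are excluded because they do not yield commutators; fuel 10 suffices for words of
    length at most 10. *)
Definition long_lyndon (s : seq bool) : bool :=
  if (1 < size s)%N then lyndon 10 s else false.

Lemma pairs_xxy : (size (ideal_pairs 10 [:: false; false; true]) <=
  count (infix [:: false; false; true]) (words 10))%N.
Proof. by vm_compute. Qed.

Lemma pairs_xyy : (size (ideal_pairs 10 [:: false; true; true]) <=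
  count (infix [:: false; true; true]) (words 10))%N.
Proof. by vm_compute. Qed.

(** The bound is 21 + 14, where 14 allows for the conjugates of the relator of level 7. *)
Lemma lyndon_xxy :
  (35 <= count (predD long_lyndon (infix [:: false; false;
    true])) (words 10))%N.
Proof. by vm_compute. Qed.

Lemma lyndon_xyy :
  (35 <= count (predD long_lyndon (infix [:: false; true; true])) (words 10))%N.
Proof. by vm_compute. Qed.

(** * Choice of the subspace for the two relators *)

Section RelationSpaces.
Variable K : finFieldType.
Local Notation A := (truncated_series K 10).
Implicit Types (a b c q r v : A) (w : seq bool) (V : {vspace A}).

(** These closure properties make the elements with series in [1 + V] a normal subgroup, see
    [relation_space_normal]. *)
Definition relation_space V :=
  (forall a b, a \in V -> b \in V -> a * b \in V) /\
  (forall a (x : bool), a \in V -> (gen K 10 x)^-1 * a * gen K 10 x \in V).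

Definition many_free_words V :=
  exists ws : seq (seq bool), [/\ sorted (relpre code ltn) ws, size ws = 21
    & forall w : seq bool, w \in ws -> [/\ long_lyndon w, (size w <= 10)%N
        & forall a, a \in V -> above (code w) a -> cf a w = 0]].

Lemma span_linear_ind (X : seq A) V (f : A -> A) :
    (forall a b, f (a + b) = f a + f b) -> (forall (k : K) a, f (k *: a) = k *:
      f a) ->
    (forall x, x \in X -> f x \in V) ->
  forall a, a \in <<X>>%VS -> f a \in V.
Proof.
move=> fD fZ fX a aX; rewrite (coord_span (X := in_tuple X) aX).
have f0 : f 0 = 0 by have := fZ 0 0; rewrite !scale0r.
rewrite (big_morph f fD f0); apply: memv_suml => i _.
by rewrite fZ; apply/memvZ/fX; rewrite mem_nth.
Qed.

(** Modulo the ideal [I] the span of [X] multiplies to zero, so only the conjugates of [X] by the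
    generators remain to be controlled. *)
Lemma relation_space_add (I : {vspace A}) (X : seq A) :
    (forall a b c, b \in I -> a * b * c \in I) ->
    (forall v v', v \in X -> v' \in X -> v * v' \in I) ->
    (forall v (x : bool), v \in X -> conj_sub x v \in (I + <<X>>)%VS) ->
  relation_space (I + <<X>>).
Proof.
move=> idealI XX cjX; split=> [a b|a x].
  case/memv_addP=> i iI [v vX ->]; case/memv_addP=> j jI [v' v'X ->].
  apply: (subvP (addvSl I <<X>>)).
  have -> : (i + v) * (j + v') = i * (j + v') + (v * j + v * v').
    by rewrite mulrDl [v * (_ + _)]mulrDr.
  rewrite !memvD //.
  - by rewrite -[i]mul1r idealI.
  - by rewrite -[_ * _]mulr1 idealI.
  apply: (span_linear_ind (f := fun a => a * v') _ _ _ vX) => [? ?|? ?|u uX].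
  - by rewrite mulrDl.
  - by rewrite scalerAl.
  apply: (span_linear_ind (f := fun a => u * a) _ _ _ v'X) => [? ?|? ?|u' u'X].
  - by rewrite mulrDr.
  - by rewrite scalerAr.
  exact: XX.
case/memv_addP=> i iI [v vX ->]; rewrite (mulrDr _ i v) (mulrDl (_ * i)) memvD
  //.
  by apply: (subvP (addvSl I <<X>>)); apply: idealI.
apply: (span_linear_ind (f := fun a => (gen K 10 x)^-1 * a * gen K 10 x) _ _ _
  vX).
- by move=> y z; rewrite (mulrDr _ y z) (mulrDl (_ * y)).
- by move=> ? ?; rewrite -scalerAr -scalerAl.
move=> u uX; rewrite -[_ * _](subrK u) memvD ?cjX //.
by apply: (subvP (addvSr I <<X>>)); apply: memv_span.
Qed.

Lemma dim_add_span (I : {vspace A}) (X : seq A) n m :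
  (\dim I <= n)%N -> (size X <= m)%N -> (\dim (I + <<X>>) <= n + m)%N.
Proof.
move=> In Xm; apply: leq_trans (dimv_add_leqif _ _).1 _.
by apply: leq_add => //; apply: leq_trans (dim_span X) Xm.
Qed.

(** Both relators have order at least 4, so products of their conjugates lie in J^8, as do
    [conj_sub x q] and [conj_sub_word w r] for [w] longer than 3. *)
Lemma relation_space_deep q r : order_ge 4 r -> order_ge 7 q ->
  exists V, [/\ r \in V, q \in V, relation_space V & many_free_words V].
Proof.
move=> hr hq; pose ws8 := [seq w <- words 10 | (8 <= size w)%N].
pose I : {vspace A} := <<[seq word K 10 w | w <- ws8]>>%VS.
pose X := q :: [seq conj_sub_word w r | w <- words 3].
have memI a : order_ge 8 a -> a \in I.
  move=> ha; apply: memv_expand => s sD s0; apply/memv_span/map_f.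
  by rewrite mem_filter mem_words sD andbT leqNgt; apply: contra s0 => /ha ->.
have Iorder a : a \in I -> order_ge 8 a.
  move=> aI s s8; apply: cf_span aI => _ /mapP[w + ->].
  rewrite mem_filter => /andP[w8 _]; rewrite cf_word.
  by case: eqP s8 => [->|]; rewrite ?andbF // ltnNge w8.
have cjwX w : (size w <= 3)%N -> conj_sub_word w r \in (I + <<X>>)%VS.
  move=> w3; apply: (subvP (addvSr I <<X>>)); apply: memv_span.
  rewrite inE; apply/orP; right; apply: (map_f (fun w => conj_sub_word w r)).
  by rewrite mem_words.
have X_order v : v \in X -> order_ge 4 v.
  rewrite inE => /predU1P[->|/mapP[w _ ->]];
    first exact: (order_geW (isT : (4 <= 7)%N) hq).
  by exact: (order_geW (leq_addr _ _) (order_ge_conj_sub_word (w := w) hr)).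
exists (I + <<X>>)%VS; split.
- exact: (cjwX [::]).
- by apply: (subvP (addvSr I <<X>>)); apply: memv_span; apply: mem_head.
- apply: relation_space_add => [a b c /Iorder hb|v v' vX v'X|v x].
  + have h0 (d : A) : order_ge 0 d by [].
    by apply: memI; apply: (order_geM (order_geM (h0 a) hb) (h0 c)).
  + by apply: memI; apply: (order_geM (X_order _ vX) (X_order _ v'X)).
  rewrite inE => /predU1P[->|/mapP[w w3 ->]].
    by apply: (subvP (addvSl I <<X>>)); apply: memI; apply: order_ge_conj_sub.
  rewrite mem_words leq_eqVlt in w3; rewrite -conj_sub_word_rcons;
    case/orP: w3 => [/eqP w3|w3].
    apply: (subvP (addvSl I <<X>>)); apply: memI.
    by have := order_ge_conj_sub_word (w := rcons w x) hr;
      rewrite size_rcons w3.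
  by apply: cjwX; rewrite size_rcons.
(* The 16 extra generators are [q] and one for each of the 15 words of length at most 3 acting on
   [r]. *)
apply: (@enough_words _ _ _ (fun w => (8 <= size w)%N) long_lyndon 16).
- move=> w w8; rewrite inE; apply/asboolP; exists (word K 10 w).
    by apply: (subvP (addvSl I <<X>>)); apply: memI; apply: (order_geW w8);
      apply: order_ge_word.
  by have [h ->] := leads_word K (size_bseq w); rewrite oner_neq0.
- apply: dim_add_span; last by [].
  by apply: leq_trans (dim_span _) _; rewrite size_map size_filter.
by vm_compute.
Qed.

(** Here [conj_sub_word w q] has order at least 11 for [w] longer than 3, and products of two such
    elements have order at least 14, so all these vanish. As [bracket q r] lies in the ideal of [r],
    the last assumption dispenses with the generator indexed by [l], which leaves 14. *)
Lemma relation_space_shallow q r (l : seq bool) : l \in words 3 -> (0 < size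
  l)%N ->
    above (code l) r -> cf r l != 0 -> order_ge 7 q ->
    (size (ideal_pairs 10 l) <= count (infix l) (words 10))%N ->
    (35 <= count (predD long_lyndon (infix l)) (words 10))%N ->
    (forall V, bracket q r \in V ->
       (forall w, size w = 3 -> w != l -> conj_sub_word w q \in V) ->
         conj_sub_word l q \in V) ->
  exists V, [/\ r \in V, q \in V, relation_space V & many_free_words V].
Proof.
move=> l3 l0 r_above rl hq pairs_l lyn_l.
move=> solve_l; set I := principal_ideal r l.
pose X := [seq conj_sub_word w q | w <- words 3 & w != l].
have l10 : (size l <= 10)%N by rewrite mem_words in l3; apply: leq_trans l3 _.
have rI a b : a * r * b \in I by apply: principal_idealP.
have X_cjw w : (size w <= 3)%N -> w != l -> conj_sub_word w q \in (I +
  <<X>>)%VS.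
  move=> w3 wl; apply: (subvP (addvSr I <<X>>)); apply: memv_span.
  by apply: (map_f (fun w => conj_sub_word w q));
    rewrite mem_filter wl mem_words.
have cjl : conj_sub_word l q \in (I + <<X>>)%VS.
  apply: solve_l => [|w w3]; last by apply: X_cjw; rewrite w3.
  apply: (subvP (addvSl I <<X>>)); rewrite bracketE.
  by have := memvB (rI q 1) (rI 1 q); rewrite mulr1 mul1r.
have cjwX w : conj_sub_word w q \in (I + <<X>>)%VS.
  have [w3|w3] := leqP (size w) 3; last first.
    suff -> : conj_sub_word w q = 0 by apply: mem0v.
    by apply: order_ge_eq0 (order_ge_conj_sub_word (w := w) hq);
      apply: (leq_add (leqnn 7) w3).
  have [->//|wl] := eqVneq w l.
  exact: X_cjw.
have X_order v : v \in X -> order_ge 7 v.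
  by case/mapP=> w _ ->; exact: (order_geW (leq_addr _ _)
    (order_ge_conj_sub_word (w := w) hq)).
exists (I + <<X>>)%VS; split.
- by apply: (subvP (addvSl I <<X>>)); have := rI 1 1; rewrite mul1r mulr1.
- exact: (cjwX [::]).
- apply: relation_space_add => [a b c bI|v v' vX v'X|v x].
  + exact: principal_idealM.
  + suff -> : v * v' = 0 by apply: mem0v.
    exact: order_ge_eq0 (order_geM (X_order _ vX) (X_order _ v'X)).
  by case/mapP=> w _ ->; rewrite -conj_sub_word_rcons.
apply: (@enough_words _ _ _ (infix l) long_lyndon 14).
- move=> w lw; rewrite inE; apply/asboolP.
  have [a aI ha] := principal_ideal_lead l10 r_above rl l0 (size_bseq w) lw.
  by exists a => //; apply: (subvP (addvSl I <<X>>)).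
- apply: dim_add_span; first exact: leq_trans (dim_principal_ideal _ _) pairs_l.
  have := count_predC (pred1 l) (words 3).
  rewrite (count_uniq_mem _ (words_uniq 3)) l3 => E.
  by rewrite size_map size_filter -(leq_add2l 1) E.
exact: lyn_l.
Qed.

Lemma mem_lie_expr V a b c :
  a \in V -> b \in V -> c \in V -> a - b - (b - c) \in V.
Proof. by move=> aV bV cV; rewrite !memvB. Qed.

Lemma mem_lie_solve V (k : K) a b c d : k != 0 ->
    k *: (a - b - (b - c)) + d \in V -> b \in V -> c \in V -> d \in V ->
  a \in V.
Proof.
move=> k0 sumV bV cV dV; have : k *: (a - b - (b - c)) \in V.
  by have := memvB sumV dV; rewrite addrK.
move/(memvZ k^-1); rewrite scalerA mulVf // scale1r => abcV.
by have := memvD (memvD abcV (memvB bV cV)) bV; rewrite subrK subrK.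
Qed.

(** The leading word of [lie3 k m] is xxy if [k] is nonzero, and xyy if only [m] is; [bracket_lie3]
    is then solved for the term indexed by this word. If both vanish, [u - 1] has order at least
    4. *)
Lemma relation_space_exists u q :
    shuffle_relations u -> order_ge 3 (u - 1) -> order_ge 7 q ->
    2%:R != 0 :> K -> 3%:R != 0 :> K ->
  exists V, [/\ u - 1 \in V, q \in V, relation_space V & many_free_words V].
Proof.
move=> su hu hq K2 K3; have := shuffle_relations_lie3 (isT : (3 <= 10)%N) su hu
  K2 K3.
set k := cf u [:: false; false; true]; set m := cf u [:: false; true;
  true] => hr.
have Hbr := @bracket_lie3 _ _ 7 k m q (u - 1) isT hq hr.
have cfu s : s != [::] -> cf (u - 1) s = cf u s.
  by rewrite cfB cf1 => /negbTE ->; rewrite subr0.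
have above_l l : size l = 3 -> 
    (forall s, size s = 3 -> (code s < code l)%N -> cf u s = 0) -> above (code
      l) (u - 1).
  move=> l3 low s sl; have := code_size (ltnW sl);
    rewrite l3 leq_eqVlt => /orP[/eqP s3|s3].
    by rewrite cfu ?low //; case: (s) s3.
  exact: hu.
have lower s : size s = 3 -> cf u s = cf (lie3 10 k m) s.
  move=> s3; apply/eqP; rewrite -subr_eq0 -cfB -(hr s) ?s3 //.
  by rewrite !cfB cf1; case: (s) s3 => //= *; rewrite subr0.
have low1 s : size s = 3 -> (code s < code [:: false; false;
  true])%N -> cf u s = 0.
  move=> s3 sl; rewrite lower //; case: s s3 sl => [|[] [|[] [|[] [|? ?]]]] // _
    _.
  rewrite /lie3 !bracketE cfD !cfZ !(mulrBl, mulrBr) !mulrA !wordM /= !cfB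
    !cf_word /=.
  by ring.
have low2 s : k = 0 -> size s = 3 -> (code s < code [:: false; true;
  true])%N -> cf u s = 0.
  move=> k0 s3 sl; rewrite lower // k0; case: s s3 sl => [|[] [|[] [|[] [|?
    ?]]]] // _ _;
  rewrite /lie3 !bracketE cfD !cfZ !(mulrBl, mulrBr) !mulrA !wordM /= !cfB
    !cf_word /=;
  by ring.
have [k0|k0] := eqVneq k 0; last first.
  pose l := [:: false; false; true].
  have l_above : above (code l) (u - 1) by exact: above_l.
  have l_neq0 : cf (u - 1) l != 0 by rewrite cfu.
  apply: (relation_space_shallow _ _ l_above l_neq0 hq pairs_xxy lyndon_xxy) =>
    //.
  move=> V; rewrite Hbr => Vbr Vcjw; apply: mem_lie_solve k0 Vbr _ _ _;
    try exact: Vcjw.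
  by apply: memvZ; apply: mem_lie_expr; apply: Vcjw.
have [m0|m0] := eqVneq m 0.
  apply: relation_space_deep => //.
  by move: hr; rewrite k0 m0 /lie3 !scale0r addr0 subr0.
pose l := [:: false; true; true].
have l_above : above (code l) (u - 1) by apply: above_l => // s; apply: low2.
have l_neq0 : cf (u - 1) l != 0 by rewrite cfu.
apply: (relation_space_shallow _ _ l_above l_neq0 hq pairs_xyy lyndon_xyy) =>
  //.
move=> V; rewrite Hbr k0 scale0r addrC => Vbr Vcjw.
by apply: mem_lie_solve m0 Vbr _ _ (mem0v V); apply: Vcjw.
Qed.

End RelationSpaces.

(** * Evaluation of the completed group algebra *)

(** A copy that carries the discrete topology, so that it can be a target in the universal property
    of the free pro-p group. *)
Definition discrete_group (gT : finGroupType) : Type := gT.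

HB.instance Definition _ (gT : finGroupType) :=
  Group.copy (discrete_group gT) gT.
HB.instance Definition _ (gT : finGroupType) :=
  Finite.copy (discrete_group gT) gT.
HB.instance Definition _ (gT : finGroupType) :=
  hasNbhs.Build (discrete_group gT) principal_filter.
HB.instance Definition _ (gT : finGroupType) :=
  Discrete_ofNbhs.Build (discrete_group gT) erefl.

Lemma card_finset_set (T : finType) (x0 : T) (S : {set T}) :
  ([set` S] #= `I_#|S|)%classic.
Proof.
have -> : [set` S]%classic = (nth x0 (enum S) @` `I_#|S|)%classic.
  apply/seteqP; split=> [x xS|_ [i iS <-]] /=.
    exists (index x (enum S)); last by rewrite nth_index ?mem_enum.
    by rewrite /= cardE index_mem mem_enum.
  by rewrite -mem_enum mem_nth // -cardE.
apply: inj_card_eq => i j; rewrite !inE /= => iS jS /eqP.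
by rewrite nth_uniq ?enum_uniq -?cardE // => /eqP.
Qed.

Section DiscreteGroup.
Variable gT : finGroupType.
Local Notation G := (discrete_group gT).
Local Open Scope classical_set_scope.

Lemma discrete_mulg_continuous : continuous (fun xy : G * G => (xy.1 * xy.2)%g).
Proof.
move=> [x y] U /nbhs_singleton Uxy; exists ([set x], [set y]).
  by split; apply: discrete_set1.
by move=> [x' y'] /= [-> ->].
Qed.

Lemma discrete_invg_continuous : continuous (fun x : G => x^-1%g).
Proof.
move=> x U /nbhs_singleton Ux; apply: (filterS _ (discrete_set1 x)).
by move=> _ ->.
Qed.

HB.instance Definition _ := Topological_isTopGroup.Build (discrete_group gT)
  discrete_mulg_continuous discrete_invg_continuous.

Lemma pro_p_discrete (p : nat) :
  prime p -> pgroup p [set: gT]%SET -> pro_p_group p G.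
Proof.
move=> p_prime pG; split.
- exact/finite_compact/finite_finset.
- exact: discrete_hausdorff.
- apply: zero_dimension_totally_disconnected => x y xy.
  exists [set x]; split=> //=; last by move=> /esym; apply/eqP.
  by split; [apply: discrete_open | apply: discrete_closed].
move=> N [_ [[N1 NV] NJ]].
pose M := [set x : gT | `[< N x >]]%SET.
have NM x : (x \in M) <-> N x by rewrite inE; split=> /asboolP.
have M_group : group_set M.
  apply/group_setP; split=> [|x y /NM Nx /NM Ny]; first exact/NM.
  apply/NM; have := NV _ _ Nx (NV _ _ N1 Ny).
  by rewrite mul1g invgK.
pose MG := Group M_group.
have [k card_k] : exists k, #|lcosets MG [set: gT]%SET| = (p ^ k)%N.
  rewrite card_lcosets.
  by have [k ->] := p_natP (pnat_dvd (dvdn_indexg _ MG) pG); exists k.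
exists k; rewrite -card_k.
have -> : cosets N = [set [set` B] | B in [set` lcosets MG [set: gT]%SET]].
  apply/seteqP; split=> [_ [x _ <-]|_ [B /lcosetsP[x _ ->] <-]].
    exists ((x : gT) *: MG)%g; first by apply/lcosetsP; exists (x : gT);
      rewrite ?finset.in_setT.
    apply/seteqP; split=> y /=.
      by case/lcosetP=> z /NM Nz ->; exists z.
    by case=> z /NM Mz <-; apply/lcosetP; exists z.
  exists x => //; apply/seteqP; split=> y /=.
    by case=> z /NM Mz <-; apply/lcosetP; exists z.
  by case/lcosetP=> z /NM Nz ->; exists z.
apply: (card_eq_trans _ (card_finset_set M _)).
apply: inj_card_eq => B C _ _ eqBC; apply/setP=> x.
have /= eqx := congr1 (fun S : set gT => S x) eqBC.
by apply/idP/idP => xB; [rewrite -eqx | rewrite eqx].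
Qed.

End DiscreteGroup.

Lemma group_hom1 (G H : groupType) (f : G -> H) : group_hom f -> f 1%g = 1%g.
Proof. by move=> fM; apply: (@mulgI _ (f 1%g)); rewrite -fM !mulg1. Qed.

Lemma group_homV (G H : groupType) (f : G -> H) x :
  group_hom f -> f x^-1%g = (f x)^-1%g.
Proof.
by move=> fM; apply: (@mulgI _ (f x)); rewrite -fM !mulgV group_hom1.
Qed.

Section Evaluation.
Variables (p D : nat) (F : topGroupType) (gT : finGroupType) (f : F -> gT).
Variable mu : gT -> truncated_series 'F_p D.
Hypothesis fM : group_hom f.
Let N : set F := (f @^-1` [set 1%g])%classic.
Hypothesis N_open : open_normal N.
Hypothesis muM : forall h k, mu (h * k)%g = mu h * mu k.
Hypotheses (mu1 : mu 1%g = 1) (mu_unip : forall h, cf (mu h) [::] = 1).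
Local Open Scope classical_set_scope.

(** The cosets of [N] are the fibres over the image of [f], which turns sums over cosets into sums
    over a finite group. *)
Let fib (h : gT) : set F := f @^-1` [set h].
Let im : pred gT := fun h => `[< exists x, f x = h >].

Let im_f x : im (f x).
Proof. by apply/asboolP; exists x. Qed.

Let coset_fib x : Defs.coset x N = fib (f x).
Proof.
apply/seteqP; split=> [_ [y Ny <-]|z fz]; rewrite /fib /=.
  by rewrite fM (Ny : f y = 1%g) mulg1.
exists (x^-1 * z)%g; last by rewrite mulKVg.
by rewrite /N /= fM (group_homV _ fM) (fz : f z = f x) mulVg.
Qed.

Let fib_inj : {in im &, injective fib}.
Proof.
move=> h k /asboolP[x <-] _ eq_hk; have : fib (f x) x by [].
by rewrite eq_hk.
Qed.

Let cosets_fib : cosets N = fib @` [set` im].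
Proof.
apply/seteqP; split=> [_ [x _ <-]|_ [h /asboolP[x <-] <-]].
  by exists (f x); rewrite ?coset_fib //; exact: im_f.
by exists x => //; rewrite coset_fib.
Qed.

Let sum_cosets (R : zmodType) (G : set F -> R) :
  \sum_(C \in cosets N) G C = \sum_(h | im h) G (fib h).
Proof.
rewrite cosets_fib fsbig_image; last first.
  by move=> h k; rewrite !inE => hi ki; apply: fib_inj.
by rewrite -(bigfs _ (index_enum_uniq _)) // => h _; rewrite mem_index_enum.
Qed.

Let imM h k : im h -> im k -> im (h * k)%g.
Proof.
by move=> /asboolP[x <-] /asboolP[y <-]; apply/asboolP; exists (x * y)%g.
Qed.

Let mulset_fib h k : im h -> mulset (fib h) (fib k) = fib (h * k)%g.
Proof.
move=> /asboolP[x <-]; apply/seteqP; split=> [_ [y fy [z fz <-]]|z fz].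
  by rewrite /fib /= fM (fy : f y = f x) (fz : f z = k).
exists x => //; exists (x^-1 * z)%g; last by rewrite mulKVg.
by rewrite /fib /= fM (group_homV _ fM) (fz : f z = _) mulKg.
Qed.

Let cga_mul_fib (a b : coset_family p F) g : im g ->
  cga_mul a b N (fib g) =
  \sum_(hk : gT * gT | [&& im hk.1, im hk.2 & (hk.1 * hk.2)%g == g])
     a N (fib hk.1) * b N (fib hk.2).
Proof.
move=> gi; rewrite /cga_mul; set S := [set _ | _].
pose P : pred (gT * gT) := fun hk => [&& im hk.1, im hk.2 & (hk.1 * hk.2)%g ==
  g].
pose fib2 (hk : gT * gT) := (fib hk.1, fib hk.2).
have -> : S = fib2 @` [set` P].
  apply/seteqP; split=> [[B C] [/=]|_ [[h k] /and3P[/= hi ki /eqP hk] <-]].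
    rewrite cosets_fib => -[h hi <-] [k ki <-]; rewrite mulset_fib // => fib_hk.
    exists (h, k) => //; apply/and3P; split=> //=; apply/eqP.
    by apply: fib_inj fib_hk => //; apply: imM.
  by rewrite /S /= cosets_fib mulset_fib // hk; split.
rewrite fsbig_image; last first.
  move=> [h k] [h' k']; rewrite !inE => /and3P[/= hi ki _] /and3P[/= h'i k'i _].
  by move=> [/fib_inj -> // /fib_inj -> //].
by rewrite -(bigfs _ (index_enum_uniq _)) // => h _; rewrite mem_index_enum.
Qed.

(** The map induced by [mu] on the group algebra of [F / N], applied to the component at [N]. *)
Definition evaluate (a : coset_family p F) : truncated_series 'F_p D :=
  \sum_(h | im h) a N (fib h) *: mu h.

Lemma evaluateM a b : evaluate (cga_mul a b) = evaluate a * evaluate b.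
Proof.
rewrite /evaluate big_distrlr /= pair_big /=.
rewrite (partition_big (fun hk : gT * gT => (hk.1 * hk.2)%g) im) /=; last first.
  by move=> [h k] /andP[/= hi ki]; apply: imM.
apply: eq_bigr => g gi; rewrite cga_mul_fib // scaler_suml.
apply: eq_big => [[h k]|[h k] /and3P[_ _ /eqP <-]] /=; first by rewrite andbA.
by rewrite muM -scalerAl -scalerAr scalerA.
Qed.

Lemma evaluateB a b : evaluate (a - b) = evaluate a - evaluate b.
Proof. by rewrite /evaluate -sumrB; apply: eq_bigr => h _;
  rewrite -scalerBl. Qed.

Lemma evaluate_elt x : evaluate (cga_elt p x) = mu (f x).
Proof.
rewrite /evaluate (bigD1 (f x)) /=; last exact: im_f.
rewrite big1 ?addr0 => [|h /andP[hi h_neq]]; rewrite /cga_elt coset_fib.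
  by rewrite asboolT // scale1r.
rewrite asboolF ?scale0r // => -[_ /fib_inj eq_h].
by rewrite eq_h ?eqxx // in h_neq; apply: im_f.
Qed.

(** The augmentation ideal evaluates into J because every [mu h] has constant term 1;
    multiplicativity does the rest. *)
Lemma evaluate_order n a : augmentation_power n a -> order_ge n (evaluate a).
Proof.
elim: n a => [//|n IHn] a /= /(_ (fun a => order_ge n.+1 (evaluate a))) h.
apply: h; split=> [|_ [b /IHn hb [c [_ c0]] <-]].
  split=> [|b c hb hc]; last by rewrite /= evaluateB; apply/order_geD/order_geN.
  by rewrite /= -(subrr 0) evaluateB subrr; apply: order_ge0.
have hc : order_ge 1 (evaluate c).
  apply: order_ge1; rewrite cf_sum; under eq_bigr do rewrite cfZ mu_unip mulr1.
  by rewrite -(sum_cosets (c N)) c0.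
by rewrite evaluateM -[n.+1]addn1; apply: (order_geM hb hc).
Qed.

Lemma zassenhaus_order n x :
  zassenhaus_filtration p n x -> order_ge n (mu (f x) - 1).
Proof. by move/evaluate_order; rewrite evaluateB !evaluate_elt (group_hom1 fM)
  mu1. Qed.

End Evaluation.

(** * The Magnus group *)

Section MagnusGroup.
Variable p : nat.
Hypothesis p_prime : prime p.
Local Notation A := (truncated_series 'F_p 10).

Definition gen_unit (x : bool) : {unit A} :=
  FinRing.unit A (unipotent_unit (cf_gen 'F_p 10 x)).

(** A finite group, as the series form a finite ring; by [magnus_pgroup] it is a valid target for
    the free pro-p group. *)
Definition magnus_group : {group {unit A}} :=
  <<[set gen_unit x | x : bool]>>%G.

(** The generators have both properties and products keep them, which suffices in a finite group. *)
Lemma magnus_groupP u : u \in magnus_group ->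
  cf (val u) [::] = 1 /\ shuffle_relations (val u).
Proof.
pose Q := [set u : {unit A} | `[< cf (val u) [::] = 1 /\ shuffle_relations (val
  u) >]]%SET.
have Q_group : group_set Q.
  apply/group_setP; split=> [|v w]; rewrite !inE.
    by rewrite FinRing.val_unit1 cf1; split=> //; apply: shuffle_relations1.
  move=> [v1 sv] [w1 sw].
  rewrite FinRing.val_unitM cf_nilM v1 w1 mulr1; split=> //.
  exact: shuffle_relationsM.
suff sMQ : magnus_group \subset Group Q_group.
  by move=> /(fintype.subsetP sMQ) uQ; have : u \in Q := uQ; rewrite !inE.
rewrite gen_subG; apply/fintype.subsetP=> v; case/imsetP=> x _ ->; rewrite !inE.
by split; [apply: cf_gen | apply: shuffle_relations_gen].
Qed.

Lemma magnus_conj (V : {vspace A}) u a : relation_space V ->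
  u \in magnus_group -> a \in V -> (val u)^-1 * a * val u \in V.
Proof.
move=> [_ VJ] uM aV.
pose Q := [set u : {unit A} | `[< forall a, a \in V -> (val u)^-1 * a * val u
  \in V >]]%SET.
have Q_group : group_set Q.
  apply/group_setP; split=> [|v w]; rewrite !inE.
    by apply/asboolP => b bV; rewrite FinRing.val_unit1 invr1 mul1r mulr1.
  move=> /asboolP hv /asboolP hw; apply/asboolP => b bV.
  have := hw _ (hv _ bV); rewrite FinRing.val_unitM invrM ?(valP v) ?(valP w)
    //.
  by rewrite !mulrA.
suff sMQ : magnus_group \subset Group Q_group.
  by have : u \in Q := fintype.subsetP sMQ u uM; rewrite inE => /asboolP; apply.
rewrite gen_subG; apply/fintype.subsetP=> v.
by case/imsetP=> x _ ->; rewrite inE; apply/asboolP => b; apply: VJ.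
Qed.

Local Notation M := (subg_of magnus_group).

Definition magnus_val (h : M) : A := val (sgval h).

Lemma magnus_valM h k : magnus_val (h * k)%g = magnus_val h * magnus_val k.
Proof. by []. Qed.

Lemma magnus_val1 : magnus_val 1%g = 1.
Proof. by []. Qed.

Lemma magnus_valX h n : magnus_val (h ^+ n)%g = magnus_val h ^+ n.
Proof.
elim: n => [|n IHn]; first by rewrite expg0 expr0.
by rewrite expgS exprS magnus_valM IHn.
Qed.

Lemma magnus_val_inj : injective magnus_val.
Proof. by move=> h k /val_inj/val_inj. Qed.

Lemma magnus_val_unip h : cf (magnus_val h) [::] = 1.
Proof. by have [] := magnus_groupP (subgP h). Qed.

Lemma magnus_val_conj (V : {vspace A}) h a : relation_space V -> a \in V ->
  magnus_val h^-1%g * a * magnus_val h \in V.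
Proof. by move=> VR aV; have := magnus_conj VR (subgP h) aV. Qed.

(** In characteristic p, raising [1 + a] to the power [p ^ 4] gives 1 plus the same power of [a],
    and [p ^ 4] is at least 16, beyond the truncation degree 10. *)
Lemma magnus_exponent (h : M) : (h ^+ (p ^ 4)%N)%g = 1%g.
Proof.
apply: magnus_val_inj; rewrite magnus_valX magnus_val1.
have pA : p \in [pchar A].
  rewrite inE p_prime /=; have := pchar_Fp p_prime;
    rewrite inE => /andP[_ /eqP p0].
  by rewrite -scaler_nat p0 scale0r.
have Fr n (a : A) : (1 + a) ^+ (p ^ n)%N = 1 + a ^+ (p ^ n)%N.
  elim: n a => [|n IHn] a; first by rewrite !expr1.
  rewrite expnS mulnC !exprM IHn -!(pFrobenius_autE pA) pFrobenius_autD_comm.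
    by rewrite pFrobenius_aut1.
  exact/commr_sym/commr1.
rewrite -[magnus_val h](subrK 1) addrC Fr.
suff -> : (magnus_val h - 1) ^+ (p ^ 4)%N = 0 by rewrite addr0.
apply: (@order_ge_eq0 _ _ (p ^ 4)%N).
  by apply: (@leq_trans (2 ^ 4)%N); rewrite // leq_exp2r // prime_gt1.
by apply: order_geX; apply: order_ge1; rewrite cfB cf1 magnus_val_unip subrr.
Qed.

Lemma magnus_pgroup : pgroup p [set: M]%SET.
Proof.
apply/pgroupP=> q q_prime /(Cauchy q_prime)[h _ oh].
have := order_dvdn h (p ^ 4)%N; rewrite magnus_exponent eqxx oh.
by rewrite Euclid_dvdX // andbT dvdn_prime2 // inE.
Qed.

End MagnusGroup.

(** * Uniqueness of the dimension of H^1 *)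

Section DimensionH1.
Variables (p : nat) (G : topGroupType).
Local Open Scope classical_set_scope.

Lemma locally_constantD (T : topologicalType) (f g : T -> 'F_p) :
  locally_constant f -> locally_constant g -> locally_constant (fun x => f x + g
    x).
Proof.
move=> fc gc c; rewrite openE => x fgx; rewrite /interior.
have fx : nbhs x (f @^-1` [set f x]) by apply: open_nbhs_nbhs; split.
have gx : nbhs x (g @^-1` [set g x]) by apply: open_nbhs_nbhs; split.
by apply: filterS (filterI fx gx) => y /= [-> ->].
Qed.

Lemma locally_constantM (T : topologicalType) (k : 'F_p) (f : T -> 'F_p) :
  locally_constant f -> locally_constant (fun x => k * f x).
Proof.
move=> fc c; rewrite openE => x fx; rewrite /interior.
have hx : nbhs x (f @^-1` [set f x]) by apply: open_nbhs_nbhs; split.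
by apply: filterS hx => y /= ->.
Qed.

Lemma cocycle1_sum d (c : 'I_d -> 'F_p) (v : 'I_d -> G -> 'F_p) :
  (forall i, cocycle1 (v i)) -> cocycle1 (fun t => \sum_i c i * v i t).
Proof.
move=> vZ; split=> [|x y]; last first.
  rewrite -sumrB -big_split big1 //= => i _.
  by rewrite -mulrBr -mulrDr (vZ i).2 mulr0.
elim: (index_enum _) => [|i r IHr].
  have -> : (fun t => \sum_(i <- [::]) c i * v i t) = fun=> 0.
    by apply/funext=> t; rewrite big_nil.
  by move=> k; rewrite openE => x kx; apply: filterS filterT.
have -> : (fun t => \sum_(j <- i :: r) c j * v j t) =
    (fun t => c i * v i t + \sum_(j <- r) c j * v j t).
  by apply/funext=> t; rewrite big_cons.
by apply: locally_constantD => //; apply/locally_constantM/(vZ i).1.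
Qed.

(** Rewriting combinations of one basis in the other is an injection of coordinate spaces over a
    finite field, which compares the dimensions. *)
Lemma dim_H1_le d d' : prime p -> dim_H1 p G d -> dim_H1 p G d' -> (d <= d')%N.
Proof.
move=> p_prime [v [vZ v_basis]] [w [wZ w_basis]].
pose comb n (u : 'I_n -> G -> 'F_p) (c : 'rV['F_p]_n) t := \sum_i c 0 i * u i t.
have combZ c : cocycle1 (comb d v c) by apply: cocycle1_sum.
have /choice[h hP] c : exists c', comb d v c = comb d' w c'.
  have [c' [c'P _]] := w_basis _ (combZ c); exists c'.
  by apply/funext=> t; have /eqP := congr1 (@^~ t) c'P;
    rewrite /= subr_eq0 => /eqP.
have h_inj : injective h.
  move=> c1 c2 eq_h; have [c [_ c_uniq]] := v_basis _ (combZ c1).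
  have B c' : comb d v c1 = comb d v c' -> c = c'.
    move=> eq_c; apply: c_uniq; apply/funext=> t.
    by apply/eqP; rewrite subr_eq0 eq_c.
  by rewrite -(B c1) // -(B c2) // hP eq_h -hP.
have := leq_card h h_inj; rewrite !card_mx card_Fp // !mul1n.
by rewrite leq_exp2l // prime_gt1.
Qed.

End DimensionH1.

Lemma card_injection_le (T : finType) (G : choiceType) (j : T -> G) :
  injective j -> finite_set [set: G]%classic ->
  (#|T| <= #|` fset_set [set: G]%classic|)%N.
Proof.
move=> j_inj finG; rewrite cardE -(size_map j); apply: uniq_leq_size.
  by rewrite map_inj_uniq // enum_uniq.
by move=> x _; rewrite in_fset_set // inE.
Qed.

Lemma smallest_subgroup (G : groupType) (S : set G) :
  subgroup (smallest (@subgroup G) S).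
Proof.
split=> [B [[B1 _] _] //|x y hx hy B [Bg SB]].
by apply: Bg.2; [apply: hx | apply: hy].
Qed.

Lemma smallest_subgroupM (G : groupType) (S : set G) x y :
  smallest (@subgroup G) S x -> smallest (@subgroup G) S y ->
  smallest (@subgroup G) S (x * y)%g.
Proof.
have [h1 hV] := smallest_subgroup S => hx hy.
by have := hV _ _ hx (hV _ _ h1 hy); rewrite mul1g invgK.
Qed.

Lemma smallest_subgroupX (G : groupType) (S : set G) x n :
  smallest (@subgroup G) S x -> smallest (@subgroup G) S (x ^+ n)%g.
Proof.
move=> hx; elim: n => [|n IHn]; first by rewrite expg0;
  case: (smallest_subgroup S).
by rewrite expgS; apply: smallest_subgroupM.
Qed.

Lemma card_eq_I0 (T : Type) (S : set T) : (S #= `I_0) -> S = set0.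
Proof. by rewrite II0 card_eq0 => /eqP. Qed.

Lemma card_eq_I1 (T : Type) (S : set T) : (S #= `I_1) -> exists x, S = [set
  x]%classic.
Proof.
case/eq_cardSP=> x Sx /card_eq_I0/seteqP[S0 _]; exists x.
apply/seteqP; split=> [y Sy|_ -> //]; apply: contrapT => yx.
by case: (S0 y).
Qed.

(** * Normal subgroups cut out by relation spaces *)

Section MagnusRelations.
Variable p : nat.
Hypothesis p_prime : prime p.
Local Notation A := (truncated_series 'F_p 10).
Variables (F : groupType) (phi : F -> subg_of (magnus_group p)).
Hypothesis phiM : group_hom phi.

Definition magnus_series (x : F) : A := magnus_val (phi x).

Local Notation mphi := magnus_series.

Lemma magnus_series1 : mphi 1%g = 1.
Proof. by rewrite /magnus_series (group_hom1 phiM). Qed.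

Lemma magnus_seriesM x y : mphi (x * y)%g = mphi x * mphi y.
Proof. by rewrite /magnus_series phiM magnus_valM. Qed.

Lemma relation_space_normal (V : {vspace A}) : relation_space V ->
  normal_subgroup (fun x : F => mphi x - 1 \in V).
Proof.
move=> VR; have [VM _] := VR; pose S (x : F) := mphi x - 1 \in V.
have S1 : S 1%g by rewrite /S magnus_series1 subrr mem0v.
have SM x y : S x -> S y -> S (x * y)%g.
  move=> Sx Sy; rewrite /S (phiM_B1 magnus_seriesM).
  by apply: memvD; [apply: memvD | apply: VM].
have SX x n : S x -> S (x ^+ n)%g.
  by move=> Sx; elim: n => [|n IHn]; rewrite ?expg0 // expgS SM.
(* Inverses are powers, since the image of [phi] has exponent dividing [p ^ 4]. *)
have SV x : S x -> S x^-1%g.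
  move=> Sx; rewrite /S; suff <- : mphi (x ^+ (p ^ 4)%N.-1)%g = mphi x^-1%g by
    apply: SX.
  rewrite /magnus_series; congr magnus_val; apply: (@mulgI _ (phi x));
    rewrite -!phiM mulgV -expgS.
  rewrite prednK ?expn_gt0 ?prime_gt0 // (group_hom1 phiM) -(magnus_exponent
    p_prime (phi x)).
  by elim: (p ^ 4)%N => [|n IHn]; rewrite ?expg0 ?(group_hom1 phiM) // !expgS
    phiM IHn.
split; first by split=> // x y Sx Sy; apply: SM => //; apply: SV.
move=> x y Sx; have -> : mphi (y^-1 * x * y)%g - 1 =
    magnus_val (phi y)^-1%g * (mphi x - 1) * mphi y.
  rewrite mulrBr mulrBl mulr1 -(group_homV _ phiM) -!magnus_seriesM mulVg
    magnus_series1.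
  by [].
exact: magnus_val_conj.
Qed.

End MagnusRelations.

(* The lower bound for the order *)
Local Close Scope ring_scope.

Theorem theorem16 (p : nat) (p_prime : prime p) (p_gt7 : 7 < p)
    (G : topGroupType) (G_type : zassenhaus_type p G 3 7)
    (a b : nat) (a_ge1 : 1 <= a) (a_le_b : a <= b)
    (Gab : abelianization_isog G ('Z_(p ^ a) * 'Z_(p ^ b))%type) :
  p ^ (21 + a + b) <= group_order G /\ p ^ 23 <= p ^ (21 + a + b).
Proof.
split; last by rewrite leq_exp2l ?prime_gt1 //; lia.
case: G_type => _ [r [_ finG [H1 _] rel_num _] rE].
case: rel_num => F [f [rel [[fM _ f_surj [d H1d F_free]] rel_sys rel_card]]].
(* The presentation carries its own value of dim H^1; uniqueness identifies the rank of [F] with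
   2. *)
have d2 : d = 2.
  by apply/eqP; rewrite eqn_leq (dim_H1_le p_prime H1d H1) (dim_H1_le p_prime H1
    H1d).
rewrite {d H1d}d2 in F_free; case: F_free => _ [x F_univ].
pose M := subg_of (magnus_group p).
pose y (i : 'I_2) : M := subg (magnus_group p) (gen_unit p (i == 1%R)).
have [phi [[phiM phi_cont phi_x] _]] :=
  F_univ (discrete_group M) (pro_p_discrete p_prime (magnus_pgroup p_prime)) y.
pose mphi := magnus_series (phi : F -> M).
pose g (c : bool) : F := x (if c then 1%R else 0%R).
have gen_g c : mphi (g c) = gen _ 10 c.
  rewrite /mphi /magnus_series phi_x /y /magnus_val subgK; first by case: c.
  by apply/mem_gen/imsetP; exists ((if c then 1%R else 0%R : 'I_2) == 1%R).
have N_open : open_normal (phi @^-1` [set 1%g])%classic.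
  split; first by move/continuousP: phi_cont; apply; apply: discrete_open.
  split; first split=> [|u v /= hu hv].
  - exact: (group_hom1 phiM).
  - by rewrite phiM hu mul1g (group_homV _ phiM) hv invg1.
  by move=> u v /= hu; rewrite !phiM hu mulg1 (group_homV _ phiM) mulVg.
have zass n z : zassenhaus_filtration p n z -> order_ge n (mphi z - 1)%R.
  exact: (zassenhaus_order phiM N_open (@magnus_valM p) (@magnus_val1 p)
    (@magnus_val_unip p)).
have [rho3 rel3] : exists z, rel 3 = [set z]%classic.
  by apply: card_eq_I1; have := rel_card 3; rewrite rE.
have [rho7 rel7] : exists z, rel 7 = [set z]%classic.
  by apply: card_eq_I1; have := rel_card 7; rewrite rE.
have rel0 n : n != 3 -> n != 7 -> rel n = set0.
  by move=> n3 n7; apply: card_eq_I0; have := rel_card n;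
    rewrite rE (negbTE n3) (negbTE n7).
have order3 : order_ge 3 (mphi rho3 - 1)%R.
  by apply: zass; have [_ /(_ rho3) h _] := rel_sys 3; have [] := h;
    rewrite ?rel3.
have order7 : order_ge 7 (mphi rho7 - 1)%R.
  by apply: zass; have [_ /(_ rho7) h _] := rel_sys 7; have [] := h;
    rewrite ?rel7.
have F_neq0 k : 0 < k < p -> (k%:R != 0 :> 'F_p)%R.
  move=> /andP[k0 kp]; rewrite -(dvdn_pcharf (pchar_Fp p_prime)).
  by apply/negP => /dvdn_leq; lia.
have [V [V3 V7 VR [ws [ws_sorted ws_size wsP]]]] :=
  relation_space_exists (magnus_groupP (subgP (phi rho3))).2 order3 order7
    (F_neq0 2 ltac:(lia)) (F_neq0 3 ltac:(lia)).
have V_normal := relation_space_normal p_prime phiM VR.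
(* The relators of level at most 10 are [rho3] and [rho7]; together with F_11, whose elements have
   series 1, they generate [R F_11] as a normal subgroup. *)
have ker_V z : f z = 1%g -> (mphi z - 1)%R \in V.
  move=> fz; have [_ _ [gen10 _]] := rel_sys 10.
  have : mulset (kernel f) (zassenhaus_filtration p 11) z.
    exists z => //; exists 1%g; rewrite ?mulg1 //.
    rewrite /zassenhaus_filtration /= subrr => B [[B0 _] _]; exact: B0.
  rewrite -gen10 => /(_ (fun u => (mphi u - 1)%R \in V)) h.
  apply: h; split=> // u [[k _ rel_u]|/zass hu]; last first.
    by rewrite (order_ge_eq0 _ hu) ?mem0v.
  have [k3|k3] := eqVneq k 3; first by move: rel_u; rewrite k3 rel3 => ->.
  have [k7|k7] := eqVneq k 7; first by move: rel_u; rewrite k7 rel7 => ->.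
  by move: rel_u; rewrite rel0.
have /choice[z zP] w : exists z, w \in ws -> leads w (mphi z - 1)%R /\
    smallest (@subgroup F) (@commutators F) z.
  have [/wsP[]|_] := boolP (w \in ws); last by exists 1%g.
  rewrite /long_lyndon; case: ifP => // w1 w_lyn w10 _.
  have [z zl zc] := lyndon_leads (magnus_seriesM phiM) (magnus_series1 phiM)
    (fun z => magnus_val_unip (phi z))
    gen_g w_lyn w10.
  by exists z => _; split=> //; apply: zc.
have prod_comm e us : {subset us <= ws} ->
    smallest (@subgroup F) (@commutators F) (word_product z us e).
  elim: us => [|u us IHus] /= us_ws; first by case: (smallest_subgroup
    (@commutators F)).
  apply: smallest_subgroupM; last by apply: IHus => w wus;
    rewrite us_ws // inE wus orbT.
  by apply: smallest_subgroupX; case: (zP u) => //; rewrite us_ws // mem_head.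
have f_comm u : smallest (@subgroup F) (@commutators F) u ->
    smallest (@subgroup G) (@commutators G) (f u).
  move/(_ (fun u => smallest (@subgroup G) (@commutators G) (f u))) => h.
  apply: h; split.
    have [C1 CV] := smallest_subgroup (@commutators G).
    split=> [|v w hv hw]; rewrite ?(group_hom1 fM) // fM (group_homV _ fM);
      exact: CV.
  move=> _ [v _ [w _ <-]] B [_ CB]; apply: CB; exists (f v) => //;
    exists (f w) => //.
  by rewrite !commgEl !conjgE !(fM, group_homV _ fM).
case: Gab => h [hM h_surj h_ker].
have /choice[s sP] t : exists u, h u = t.
  by have : (h @` setT)%classic t; [rewrite h_surj | case=> u _ <-; exists u].
have h_prod e : h (f (word_product z ws e)) = 0%R.
  suff : (h @^-1` [set 0%R])%classic (f (word_product z ws e)) by [].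
  rewrite h_ker; apply: subset_closure.
  exact: (f_comm _ (prod_comm e ws (fun w w_ws => w_ws))).
(* The bound is the cardinal of [T]: 21 exponents below [p] and a class in the abelianization.
   Exponents are extended by 0 outside [ws]. *)
pose T := ({ffun seq_sub ws -> 'I_p} * ('Z_(p ^ a) * 'Z_(p ^ b)))%type.
pose ext (e : {ffun seq_sub ws -> 'I_p}) w : nat := oapp (fun i => e i : nat) 0
  (insub w).
pose j (t : T) : G := (s t.2 * f (word_product z ws (ext t.1)))%g.
(* Applying [h] kills the product of commutators and recovers the abelian component. Cancelling it
   leaves two products with equal image in [G], whose quotient therefore has its series in
   [1 + V]. *)
have j_inj : injective j.
  move=> [e t] [e' t'] eq_j; have eq_t : t = t'.
    by have := congr1 h eq_j; rewrite /j !hM !h_prod !sP !addr0.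
  move: eq_j; rewrite /j /= eq_t => /mulgI eq_f; congr (_, _).
  have : (mphi (word_product z ws (ext e) * (word_product z ws (ext e'))^-1)%g -
    1)%R
      \in V.
    by apply: ker_V; rewrite fM (group_homV _ fM) eq_f mulgV.
  have ext_lt e0 w : ext e0 w < p.
    by rewrite /ext; case: insub => [i|] /=;
      [apply: ltn_ord | apply: prime_gt0].
  have wp_inj := @word_product_inj _ _ _ _ (magnus_seriesM phiM)
    (magnus_series1 phiM) (fun u => magnus_val_unip (phi u))
    (fun c => c \in V) V_normal p z (pchar_Fp p_prime) ws (ext e) (ext e')
      ws_sorted.
  move=> prodV; have eq_ext : {in ws, ext e =1 ext e'}.
    apply: wp_inj prodV => w w_ws; have [wl _] := zP w w_ws.
    by have [_ _ wV] := wsP w w_ws; split; rewrite ?ext_lt.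
  apply/ffunP => i; apply: val_inj.
  have valE (e0 : {ffun seq_sub ws -> 'I_p}) : val (e0 i) = ext e0 (val i).
    by rewrite /ext valK.
  by rewrite !valE eq_ext // (valP i).
have := card_injection_le j_inj finG; rewrite !card_prod card_ffun card_ord.
have ws_uniq : uniq ws.
  by apply: sorted_uniq ws_sorted => [? ? ?|?];
    [apply: ltn_trans | apply: ltnn].
(* ['Z_n] has [n] elements only for [n > 1], which is where the positivity of [a] and [b] enters. *)
rewrite card_seq_sub // ws_size !card_ord !Zp_cast; last first.
- by rewrite -(exp1n a) ltn_exp2r // prime_gt1.
- by rewrite -(exp1n b) ltn_exp2r ?prime_gt1 // (leq_trans a_ge1).
by rewrite -addnA !expnD.
Qed.
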